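(* Consider a system of $n_b$ rigid bodies with Lagrangian $L=T-U=\tfrac12\langle\mathsf{H}y_1,E\,\mathsf{H}y_1\rangle-U(y)$, subject to the external force $F_e$, with holonomic constraints $g=0$ and constrained state space $M=M_\theta\cap M_{\mathsf{hc}}\subset J_1(\mathcal{E})$. For every $p=(t,y,y_1)\in M$, the linear system $$\begin{cases} E\,d+\mathsf{H}\,dg^T\lambda=F_e-8\tilde K-\mathsf{H}\nabla U\\ dg\,\mathsf{H}^Td=dg\,\mathsf{I}\,y-d^2g(y_1,y_1)\end{cases}$$ has a unique solution $(d,\lambda)\in\mathbb{R}^{6n_b}\times\mathbb{R}^\ell$. Setting $y_2=\mathsf{H}^Td-\mathsf{I}y$ and $\mathcal{D}_p=\mathrm{span}\{(1,y_1,y_2)\}$ defines a one-dimensional distribution on $M$ (that is, $\mathcal{D}_p\subset T_pM\cap\mathcal{C}_p$ for all $p\in M$), and it is the distribution of the dynamics: a smooth curve $t\mapsto y(t)$ is a motion of the constrained system if and only if $t\mapsto(t,y(t),y'(t))$ is a curve in $M$ which is an integral curve of $\mathcal{D}$. Moreover, along every such motion the energy $W=T+U=\tfrac12\langle\mathsf{H}y_1,E\,\mathsf{H}y_1\rangle+U(y)$ satisfies $$\frac{dW}{dt}=\langle\mathsf{H}y_1,F_e\rangle.$$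
   Context: All data are smooth. The bundle is $\mathcal{E}=\mathbb{R}\times\mathbb{R}^{7n_b}\to\mathbb{R}$ with fibre coordinates $y=(r^{(1)},\theta^{(1)},\dots,r^{(n_b)},\theta^{(n_b)})$, where $r^{(i)}\in\mathbb{R}^3$ is the centre of mass of the $i$th body and $\theta^{(i)}\in\mathbb{R}^4$ its Euler parameters (to be constrained to the unit sphere $S^3$). $J_1(\mathcal{E})\simeq\mathbb{R}^{14n_b+1}$ has coordinates $(t,y,y_1)$; along a curve, subscripts $1,2$ mean first and second derivatives in $t$. The Cartan distribution is $\mathcal{C}_p=\{v\in T_pJ_1(\mathcal{E}) : (dy^k-y^k_1dt)(v)=0,\ k=1,\dots,7n_b\}$. For $\theta=(\theta^0,\theta^1,\theta^2,\theta^3)\in\mathbb{R}^4$, $$H(\theta)=\begin{pmatrix}-\theta^1&\theta^0&\theta^3&-\theta^2\\-\theta^2&-\theta^3&\theta^0&\theta^1\\-\theta^3&\theta^2&-\theta^1&\theta^0\end{pmatrix},\qquad H^{(i)}=H(\theta^{(i)}),\quad H^{(i)}_1=H(\theta^{(i)}_1).$$ The $i$th body has mass $m_i>0$ and inertia tensor $\mathbb{I}^{(i)}\in\mathbb{R}^{3\times3}$ (symmetric positive definite). $F^{(i)}\in\mathbb{R}^3$ is the external force on body $i$ (at its centre of mass) and $\tau^{(i)}\in\mathbb{R}^3$ the external torque on it in its body coordinates; these are given functions of $(t,y,y_1)$. $U$ is a real function of $y$, with gradient $\nabla U\in\mathbb{R}^{7n_b}$. The constraint map $g:\mathcal{E}\to\mathbb{R}^\ell$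 does not depend on $t$; $dg$ is its $\ell\times7n_b$ Jacobian in $y$ and $d^2g(y_1,y_1)\in\mathbb{R}^\ell$ its second differential, taken componentwise. For each body, $$\mathsf{H}^{(i)}=\begin{pmatrix}I_3&0\\0&H^{(i)}\end{pmatrix},\quad \mathsf{I}^{(i)}=\begin{pmatrix}0&0\\0&|\theta^{(i)}_1|^2I_4\end{pmatrix}\in\mathbb{R}^{7\times7},\quad E^{(i)}=\begin{pmatrix}m_iI_3&0\\0&4\mathbb{I}^{(i)}\end{pmatrix},\quad \tilde K^{(i)}=\begin{pmatrix}0\\H^{(i)}(H_1^{(i)})^T\mathbb{I}^{(i)}H^{(i)}\theta^{(i)}_1\end{pmatrix},$$ $F_e^{(i)}=(F^{(i)},2\tau^{(i)})$. Then $E,\mathsf{I},\mathsf{H}$ are the block diagonal matrices with blocks $E^{(i)},\mathsf{I}^{(i)},\mathsf{H}^{(i)}$, and $F_e=(F_e^{(1)},\dots,F_e^{(n_b)})$, $\tilde K=(\tilde K^{(1)},\dots,\tilde K^{(n_b)})$. The kinetic energy is $T=\sum_i\big(\tfrac12m_i|r_1^{(i)}|^2+2\langle H^{(i)}\theta_1^{(i)},\mathbb{I}^{(i)}H^{(i)}\theta_1^{(i)}\rangle\big)=\tfrac12\langle\mathsf{H}y_1,E\mathsf{H}y_1\rangle$. $M_\theta=\{(t,y,y_1): |\theta^{(i)}|^2=1,\ \langle\theta^{(i)},\theta_1^{(i)}\rangle=0,\ i=1,\dots,n_b\}$, $M_{\mathsf{hc}}=\{(t,y,y_1): g(y)=0,\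 dg\,y_1=0\}$, $M=M_\theta\cap M_{\mathsf{hc}}$. The $\ell$ constraints are assumed independent: $dg\,\mathsf{H}^T$ has rank $\ell$ at all points of $M$. Motions. A smooth curve $y$ is a motion of the constrained system if $|\theta^{(i)}(t)|=1$ for all $i$ and $g(y(t))=0$ for all $t$, and for all local parametrisations $\varphi^{(i)}:U^{(i)}\subset\mathbb{R}^3\to S^3$ (diffeomorphisms onto open subsets of $S^3$), whenever $\theta^{(i)}=\varphi^{(i)}(\alpha^{(i)})$ for all $i$, and with $q=(r^{(1)},\alpha^{(1)},\dots,r^{(n_b)},\alpha^{(n_b)})$, $y=\Phi(q)$ the corresponding parametrisation, there is $\lambda(t)\in\mathbb{R}^\ell$ such that $$\frac{d}{dt}\frac{\partial L}{\partial q_1}-\frac{\partial L}{\partial q}=\mathcal{F}-d(g\circ\Phi)^T\lambda,$$ where $\mathcal{F}$ has $i$th block $\big(F^{(i)},\,2(d\varphi^{(i)})^T(H^{(i)})^T\tau^{(i)}\big)$ and $L=T-U$ is expressed in $(q,q_1)$ through $y=\Phi(q)$, $y_1=d\Phi\,q_1$. *)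

(* Defs.v *)
From HB Require Import structures.
From mathcomp Require Import all_boot all_order all_algebra.
From mathcomp Require Import all_classical all_reals all_analysis.

Set Implicit Arguments.
Unset Strict Implicit.
Unset Printing Implicit Defensive.

Import Order.TTheory GRing.Theory Num.Theory.
Import numFieldNormedType.Exports.

Local Open Scope classical_set_scope.
Local Open Scope ring_scope.

(* [Ck k A f]: f is of class C^k on A, meant for A open and finite-dimensional
   V, where C^k is equivalent to the existence and continuity of all iterated
   directional derivatives up to order k. *)
Fixpoint Ck (R : realType) (V W : normedModType R) (k : nat) (A : set V)
    (f : V -> W) : Prop :=
  if k is k'.+1 then
    (forall x, A x -> differentiable f x) /\ (forall v, Ck k' A ('D_v f))
  else forall x, A x -> {for x, continuous f}.

Definition smooth_on (R : realType) (V W : normedModType R) (A : set V)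
    (f : V -> W) : Prop := forall k, Ck k A f.

(* The norm that the library puts on matrices is the sup norm; Euclidean norms
   are always written with [dot]. *)
Definition dot (R : realType) (n : nat) (u v : 'cV[R]_n) : R :=
  (u^T *m v) 0 0.

Definition jac (R : realType) (n m : nat) (f : 'cV[R]_n -> 'cV[R]_m)
    (x : 'cV[R]_n) : 'M[R]_(m, n) :=
  \matrix_(i, j) ('D_(delta_mx j 0) f x) i 0.

Definition grad (R : realType) (n : nat) (f : 'cV[R]_n -> R) (x : 'cV[R]_n) :
    'cV[R]_n :=
  \col_j 'D_(delta_mx j 0) (f : 'cV[R]_n -> R^o) x.

Definition d2 (R : realType) (n m : nat) (f : 'cV[R]_n -> 'cV[R]_m)
    (x u v : 'cV[R]_n) : 'cV[R]_m :=
  'D_u (fun z => 'D_v f z) x.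

Definition sphere3 (R : realType) : set 'cV[R]_4 := [set x | dot x x = 1].

(* T_p S for an embedded submanifold S of V: velocities at p of the smooth
   curves in S through p. *)
Definition tangent (R : realType) (V : normedModType R) (S : set V) (p : V) :
    set V :=
  [set v | exists (e : R) (c : R^o -> V),
    [/\ 0 < e, smooth_on (ball (0 : R^o) e) c,
        forall s, ball (0 : R^o) e s -> S (c s),
        c 0 = p & derive1 c 0 = v]].

(* Diffeomorphism from the open set O of R^3 onto an open subset of S^3: the
   image is S^3 `&` V with V open in R^4, and the inverse is the restriction of
   a smooth map on V. *)
Definition local_param (R : realType) (O : set 'cV[R]_3)
    (phi : 'cV[R]_3 -> 'cV[R]_4) : Prop :=
  [/\ open O, smooth_on O phi &
      exists (V : set 'cV[R]_4) (psi : 'cV[R]_4 -> 'cV[R]_3),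
        [/\ open V, smooth_on V psi, phi @` O = @sphere3 R `&` V &
            forall a, O a -> psi (phi a) = a]].

(* R^(7 nb) and R^(6 nb), cut into one block per body. *)
Notation ydim nb := (\sum_(i < nb) (3 + 4))%N.
Notation qdim nb := (\sum_(i < nb) (3 + 3))%N.

(* J_1(E), with points (t, y, y_1). *)
Notation jet R nb := (R^o * 'cV[R]_(ydim nb) * 'cV[R]_(ydim nb))%type.

Definition pos (R : realType) (nb : nat) (y : 'cV[R]_(ydim nb)) (i : 'I_nb) :
    'cV[R]_3 := usubmx (submxcol y i : 'cV[R]_(3 + 4)).

Definition theta (R : realType) (nb : nat) (y : 'cV[R]_(ydim nb)) (i : 'I_nb) :
    'cV[R]_4 := dsubmx (submxcol y i : 'cV[R]_(3 + 4)).

Definition Hmat (R : realType) (x : 'cV[R]_4) : 'M[R]_(3, 4) :=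
  let th k := x (inord k) 0 in
  \matrix_(i < 3, j < 4)
    nth 0 (nth [::]
      [:: [:: - th 1; th 0; th 3; - th 2];
          [:: - th 2; - th 3; th 0; th 1];
          [:: - th 3; th 2; - th 1; th 0]] i) j.

(* [Hbig], [Ibig], [Ebig] are the block diagonal matrices H, I and E of the
   system; [m] are the masses and [J] the inertia tensors. *)
Definition Hbig (R : realType) (nb : nat) (y : 'cV[R]_(ydim nb)) :
    'M[R]_(qdim nb, ydim nb) :=
  \mxblock_(i < nb, j < nb)
    if i == j then block_mx 1%:M 0 0 (Hmat (theta y i)) : 'M[R]_(3 + 3, 3 + 4)
    else 0.

Definition Ibig (R : realType) (nb : nat) (y1 : 'cV[R]_(ydim nb)) :
    'M[R]_(ydim nb) :=
  \mxdiag_(i < nb)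
    (block_mx 0 0 0 (dot (theta y1 i) (theta y1 i))%:M : 'M[R]_(3 + 4)).

Definition Ebig (R : realType) (nb : nat) (m : 'I_nb -> R)
    (J : 'I_nb -> 'M[R]_3) : 'M[R]_(qdim nb) :=
  \mxdiag_(i < nb) (block_mx (m i)%:M 0 0 (4 *: J i) : 'M[R]_(3 + 3)).

Definition Ktilde (R : realType) (nb : nat) (J : 'I_nb -> 'M[R]_3)
    (y y1 : 'cV[R]_(ydim nb)) : 'cV[R]_(qdim nb) :=
  \mxcol_(i < nb)
    (col_mx 0 (Hmat (theta y i) *m (Hmat (theta y1 i))^T *m J i
               *m Hmat (theta y i) *m theta y1 i) : 'cV[R]_(3 + 3)).

Definition Fext (R : realType) (nb : nat) (F tau : 'I_nb -> jet R nb -> 'cV[R]_3)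
    (p : jet R nb) : 'cV[R]_(qdim nb) :=
  \mxcol_(i < nb) (col_mx (F i p) (2 *: tau i p) : 'cV[R]_(3 + 3)).

Definition kinetic (R : realType) (nb : nat) (m : 'I_nb -> R)
    (J : 'I_nb -> 'M[R]_3) (y y1 : 'cV[R]_(ydim nb)) : R :=
  \sum_(i < nb) (2^-1 * m i * dot (pos y1 i) (pos y1 i)
    + 2 * dot (Hmat (theta y i) *m theta y1 i)
              (J i *m (Hmat (theta y i) *m theta y1 i))).

Lemma kineticE (R : realType) (nb : nat) (m : 'I_nb -> R)
    (J : 'I_nb -> 'M[R]_3) (y y1 : 'cV[R]_(ydim nb)) :
  kinetic m J y y1 =
    2^-1 * dot (Hbig y *m y1) (Ebig m J *m (Hbig y *m y1)).
Proof.
have -> : Hbig y *m y1 = \mxcol_(i < nb) (col_mx (pos y1 i)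
    (Hmat (theta y i) *m theta y1 i) : 'cV[R]_(3 + 3)).
  rewrite -[in LHS](submxcolK y1) /Hbig mul_mxblock_mxrow; apply: eq_mxcol => i.
  rewrite (bigD1 i) //= eqxx big1 ?addr0 => [|j ji].
    rewrite -[submxcol y1 i](@vsubmxK _ 3 4) mul_block_col mul1mx !mul0mx.
    by rewrite addr0 add0r.
  by rewrite eq_sym (negbTE ji) mul0mx.
rewrite /Ebig /mxdiag mul_mxblock_mxrow /dot tr_mxcol mul_mxrow_mxcol summxE.
rewrite mulr_sumr; apply: eq_bigr => i _.
rewrite (bigD1 i) //= eqxx conform_mx_id big1 ?addr0 => [|j ji]; last first.
  by rewrite eq_sym (negbTE ji) mul0mx.
rewrite mul_block_col !mul0mx addr0 add0r tr_col_mx mul_row_col mul_scalar_mx.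
rewrite -scalemxAl -!scalemxAr [in RHS]mxE mulrDr.
rewrite ![X in _ = _ * X + _]mxE ![X in _ = _ + _ * X]mxE !mulrA.
congr (_ + _ * _); apply: (mulfI (x := 2)); rewrite ?pnatr_eq0 //.
by rewrite mulVKf ?pnatr_eq0 // -natrM.
Qed.

Definition lagrangian (R : realType) (nb : nat) (m : 'I_nb -> R)
    (J : 'I_nb -> 'M[R]_3) (U : 'cV[R]_(ydim nb) -> R)
    (y y1 : 'cV[R]_(ydim nb)) : R := kinetic m J y y1 - U y.

Definition energy (R : realType) (nb : nat) (m : 'I_nb -> R)
    (J : 'I_nb -> 'M[R]_3) (U : 'cV[R]_(ydim nb) -> R)
    (y y1 : 'cV[R]_(ydim nb)) : R := kinetic m J y y1 + U y.

Definition Mtheta (R : realType) (nb : nat) : set (jet R nb) :=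
  [set p : jet R nb | forall i, dot (theta p.1.2 i) (theta p.1.2 i) = 1 /\
                     dot (theta p.1.2 i) (theta p.2 i) = 0].

Definition Mhc (R : realType) (nb l : nat)
    (g : 'cV[R]_(ydim nb) -> 'cV[R]_l) : set (jet R nb) :=
  [set p : jet R nb | g p.1.2 = 0 /\ jac g p.1.2 *m p.2 = 0].

Definition Mset (R : realType) (nb l : nat)
    (g : 'cV[R]_(ydim nb) -> 'cV[R]_l) : set (jet R nb) :=
  @Mtheta R nb `&` Mhc g.

Definition cartan (R : realType) (nb : nat) (p : jet R nb) : set (jet R nb) :=
  [set v : jet R nb | forall k, v.1.2 k 0 - p.2 k 0 * v.1.1 = 0].

Definition dynsys (R : realType) (nb l : nat) (m : 'I_nb -> R)
    (J : 'I_nb -> 'M[R]_3) (F tau : 'I_nb -> jet R nb -> 'cV[R]_3)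
    (U : 'cV[R]_(ydim nb) -> R) (g : 'cV[R]_(ydim nb) -> 'cV[R]_l)
    (p : jet R nb) (d : 'cV[R]_(qdim nb)) (lam : 'cV[R]_l) : Prop :=
  let y := p.1.2 in let y1 := p.2 in
  Ebig m J *m d + Hbig y *m (jac g y)^T *m lam
    = Fext F tau p - 8 *: Ktilde J y y1 - Hbig y *m grad U y
  /\ jac g y *m (Hbig y)^T *m d = jac g y *m Ibig y1 *m y - d2 g y y1 y1.

Definition accel (R : realType) (nb : nat) (p : jet R nb)
    (d : 'cV[R]_(qdim nb)) : 'cV[R]_(ydim nb) :=
  (Hbig p.1.2)^T *m d - Ibig p.2 *m p.1.2.

Definition prolong (R : realType) (nb : nat) (y : R -> 'cV[R]_(ydim nb)) :
    R^o -> jet R nb := fun t => (t, y t, derive1 y t).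

Definition integral_curve (R : realType) (nb : nat) (S : set (jet R nb))
    (D : jet R nb -> {vspace jet R nb}) (I : set R) (c : R^o -> jet R nb) :
    Prop :=
  forall t, I t -> [/\ S (c t), derivable c t 1 & derive1 c t \in D (c t)].

Definition rpart (R : realType) (nb : nat) (q : 'cV[R]_(qdim nb)) (i : 'I_nb) :
    'cV[R]_3 := usubmx (submxcol q i : 'cV[R]_(3 + 3)).

Definition apart (R : realType) (nb : nat) (q : 'cV[R]_(qdim nb)) (i : 'I_nb) :
    'cV[R]_3 := dsubmx (submxcol q i : 'cV[R]_(3 + 3)).

Definition Phi (R : realType) (nb : nat)
    (phi : 'I_nb -> 'cV[R]_3 -> 'cV[R]_4) (q : 'cV[R]_(qdim nb)) :
    'cV[R]_(ydim nb) :=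
  \mxcol_(i < nb) (col_mx (rpart q i) (phi i (apart q i)) : 'cV[R]_(3 + 4)).

(* L and the generalized force in the coordinates (q, q_1) of a chart. *)
Definition Lloc (R : realType) (nb : nat) (m : 'I_nb -> R)
    (J : 'I_nb -> 'M[R]_3) (U : 'cV[R]_(ydim nb) -> R)
    (phi : 'I_nb -> 'cV[R]_3 -> 'cV[R]_4) (q q1 : 'cV[R]_(qdim nb)) : R :=
  lagrangian m J U (Phi phi q) (jac (Phi phi) q *m q1).

Definition Floc (R : realType) (nb : nat)
    (F tau : 'I_nb -> jet R nb -> 'cV[R]_3)
    (phi : 'I_nb -> 'cV[R]_3 -> 'cV[R]_4) (q : 'cV[R]_(qdim nb))
    (p : jet R nb) : 'cV[R]_(qdim nb) :=
  \mxcol_(i < nb) (col_mx (F i p)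
    (2 *: ((jac (phi i) (apart q i))^T *m (Hmat (theta p.1.2 i))^T
           *m tau i p)) : 'cV[R]_(3 + 3)).

(* [I'] is there because a chart may cover only part of the curve. *)
Definition motion (R : realType) (nb l : nat) (m : 'I_nb -> R)
    (J : 'I_nb -> 'M[R]_3) (F tau : 'I_nb -> jet R nb -> 'cV[R]_3)
    (U : 'cV[R]_(ydim nb) -> R) (g : 'cV[R]_(ydim nb) -> 'cV[R]_l)
    (I : set R) (y : R -> 'cV[R]_(ydim nb)) : Prop :=
  [/\ forall t i, I t -> sphere3 (theta (y t) i),
      forall t, I t -> g (y t) = 0 &
      forall (O : 'I_nb -> set 'cV[R]_3) (phi : 'I_nb -> 'cV[R]_3 -> 'cV[R]_4)
        (I' : set R) (alpha : 'I_nb -> R -> 'cV[R]_3),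
        (forall i, local_param (O i) (phi i)) ->
        open I' -> is_interval I' -> I' `<=` I ->
        (forall t i, I' t ->
          O i (alpha i t) /\ theta (y t) i = phi i (alpha i t)) ->
        let q : R -> 'cV[R]_(qdim nb) := fun t =>
          \mxcol_(i < nb)
            (col_mx (pos (y t) i) (alpha i t) : 'cV[R]_(3 + 3)) in
        exists lam : R -> 'cV[R]_l, forall t, I' t ->
          derive1 (fun s => grad (Lloc m J U phi (q s)) (derive1 q s)) t
            - grad (fun x => Lloc m J U phi x (derive1 q t)) (q t)
          = Floc F tau phi (q t) (prolong y t)
            - (jac (g \o Phi phi) (q t))^T *m lam t].

(* Main.v *)
(* In a chart the Euler-Lagrange covector is the pullback by [(d Phi)^T] of an
   ambient covector of R^(7 n_b).  Since [d Phi = H^T C] with [C] invertible, it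
   vanishes exactly when [H] annihilates the ambient covector.  As
   [H(th) v = - H(v) th], applying [H] to the inertial part leaves
   [E H y_2 + 8 K], so a motion satisfies the first line of the linear system
   with [d = H y_2]; differentiating the constraints twice gives the second
   line, and [H^T H] is the identity minus the normal projections, which turns
   [d = H y_2] into [y_2 = H^T d - I y].

   Tangency of the distribution needs curves in [M].  All holonomic constraints,
   including [|th_i|^2 = 1], form one map [h], and [M] is the set of (t, y, y_1)
   with [h y = 0] and [dh(y) y_1 = 0].  The implicit function theorem corrects
   the 2-jet [y + s y_1 + s^2 y_2 / 2] to a curve [Y] in [h = 0], and
   [(t + s, Y, Y')] is the curve wanted. *)
Require Import Defs.
From HB Require Import structures.
From mathcomp Require Import all_boot all_order all_algebra.
From mathcomp Require Import ring lra.
From mathcomp Require Import all_classical all_reals all_analysis.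

Set Implicit Arguments.
Unset Strict Implicit.
Unset Printing Implicit Defensive.

Import Order.TTheory GRing.Theory Num.Theory.
Import numFieldNormedType.Exports.

Local Open Scope classical_set_scope.
Local Open Scope ring_scope.

(** * Differential calculus on matrices *)

(** A motion is defined through charts only, and the two directions of the equivalence meet them
    differently. To read off the acceleration of a motion at a given time, a chart around that point
    of the curve has to be produced; stereographic projection supplies it. Its multiplier comes with
    the chart, and only the uniqueness of [d] in the linear system ties it to the distribution.
    Conversely the charts are arbitrary and the parameters [alpha] are mere functions of time; they
    are smooth because the inverse charts are.

    The coefficient 8 is 4 + 4: differentiating the momentum and differentiating the kinetic energy
    in [y] give the same term, and each copy carries the 4 of the blocks [4 J] of [E].

    In the tangency argument, the correction supplied by the implicit function does not disturb the
    2-jet at [s = 0], because that jet already satisfies the constraints differentiated once and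
    twice. Since [tangent] asks for smooth curves in [M], the implicit function must be smooth to
    every order. *)

Section MatrixCalculus.
Context {R : realType} {V : normedModType R}.

Lemma differentiable_mx m n (f : V -> 'M[R]_(m, n)) x :
  (forall i j, differentiable (fun z => f z i j : R^o) x) ->
  differentiable f x.
Proof.
move=> df; rewrite (_ : f = \sum_i \sum_j (fun z => f z i j *: delta_mx i j)).
  by apply: differentiable_sum => i; apply: differentiable_sum => j;
    exact: differentiableZl.
apply/funext => z; rewrite [LHS]matrix_sum_delta fct_sumE.
by apply: eq_bigr => i _; rewrite fct_sumE.
Qed.

Lemma differentiable_entry m n (f : V -> 'M[R]_(m, n)) x i j :
  differentiable f x -> differentiable (fun z => f z i j : R^o) x.
Proof.
move=> df; apply: (@differentiable_comp _ _ _ _ f (fun M => M i j : R^o)) => //.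
exact: differentiable_coord.
Qed.

Lemma derive_entry m n (f : V -> 'M[R]_(m, n)) x v i j :
  derivable f x v -> ('D_v f x) i j = 'D_v (fun z => f z i j : R^o) x.
Proof. by move=> df; rewrite derive_mx // mxE. Qed.

Lemma is_derive_mx m n (f : V -> 'M[R]_(m, n)) (df : 'M[R]_(m, n)) x v :
  (forall i j, is_derive x v (fun z => f z i j : R^o) (df i j)) ->
  is_derive x v f df.
Proof.
move=> h; have D : derivable f x v by apply/derivable_mxP => i j.
apply: DeriveDef => //; apply/matrixP => i j; rewrite derive_entry //.
exact: derive_val.
Qed.

Lemma is_derive_entry m n (f : V -> 'M[R]_(m, n)) (df : 'M[R]_(m, n)) x v i j :
  is_derive x v f df -> is_derive x v (fun z => f z i j : R^o) (df i j).
Proof.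
move=> [D <-]; rewrite derive_entry //; apply: derivableP.
by move/derivable_mxP : D; exact.
Qed.

Lemma is_derive_mulmx m n p (f : V -> 'M[R]_(m, n)) (g : V -> 'M[R]_(n, p))
    (df : 'M[R]_(m, n)) (dg : 'M[R]_(n, p)) x v :
  is_derive x v f df -> is_derive x v g dg ->
  is_derive x v (fun z => f z *m g z) (df *m g x + f x *m dg).
Proof.
move=> hf hg; apply: is_derive_mx => i j.
rewrite (_ : (fun _ => _) =
    \sum_k ((fun z => f z i k : R^o) * (fun z => g z k j : R^o))); last first.
  by apply/funext => z; rewrite mxE fct_sumE.
have hf' := fun k => is_derive_entry i k hf.
have hg' := fun k => is_derive_entry k j hg.
apply: is_derive_eq; rewrite !mxE -big_split /=; apply: eq_bigr => k _.
by rewrite addrC [_ *: df _ _]mulrC.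
Qed.

Lemma is_derive_mulmxl m n p (M : 'M[R]_(m, n)) (f : V -> 'M[R]_(n, p))
    (df : 'M[R]_(n, p)) x v :
  is_derive x v f df -> is_derive x v (fun z => M *m f z) (M *m df).
Proof.
move=> hf; have := is_derive_mulmx (is_derive_cst M x v) hf.
by rewrite mul0mx add0r.
Qed.

Lemma is_derive_mulmxr m n p (M : 'M[R]_(n, p)) (f : V -> 'M[R]_(m, n))
    (df : 'M[R]_(m, n)) x v :
  is_derive x v f df -> is_derive x v (fun z => f z *m M) (df *m M).
Proof.
move=> hf; have := is_derive_mulmx hf (is_derive_cst M x v).
by rewrite mulmx0 addr0.
Qed.

Lemma is_derive_trmx m n (f : V -> 'M[R]_(m, n)) (df : 'M[R]_(m, n)) x v :
  is_derive x v f df -> is_derive x v (fun z => (f z)^T) df^T.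
Proof.
move=> hf; apply: is_derive_mx => i j; rewrite mxE.
under eq_fun do rewrite mxE; exact: is_derive_entry.
Qed.

Lemma is_derive_dot n (f g : V -> 'cV[R]_n) (df dg : 'cV[R]_n) x v :
  is_derive x v f df -> is_derive x v g dg ->
  is_derive x v (fun z => dot (f z) (g z) : R^o) (dot df (g x) + dot (f x) dg).
Proof.
move=> hf hg.
have := is_derive_entry 0 0 (is_derive_mulmx (is_derive_trmx hf) hg).
by rewrite mxE.
Qed.

Lemma is_derive_diff (W : normedModType R) (f : V -> W) x v :
  differentiable f x -> is_derive x v f ('D_v f x).
Proof. by move=> df; apply: derivableP; exact: diff_derivable. Qed.

Lemma deriveZv (W : normedModType R) (f : V -> W) x (k : R) v :
  differentiable f x -> 'D_(k *: v) f x = k *: 'D_v f x.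
Proof. by move=> df; rewrite !deriveE // linearZ. Qed.

End MatrixCalculus.

(** In finite dimension continuity comes for free: the map is a finite sum of coordinates times
    fixed vectors. *)
Lemma linear_mx_differentiable (R : realType) m n (W : normedModType R)
  (f : {linear 'M[R]_(m, n) -> W}) x : differentiable f x.
Proof.
rewrite (_ : (f : _ -> _) =
    \sum_i \sum_j (fun z : 'M[R]_(m, n) => z i j *: f (delta_mx i j))).
  apply: differentiable_sum => i; apply: differentiable_sum => j.
  by apply: differentiableZl; exact: differentiable_coord.
apply/funext => z; rewrite [in LHS](matrix_sum_delta z) linear_sum fct_sumE.
apply: eq_bigr => i _; rewrite linear_sum fct_sumE.
by apply: eq_bigr => j _; rewrite linearZ.
Qed.

Lemma derive_comp (R : realType) (U V W : normedModType R) (f : V -> W)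
    (g : U -> V) x v : differentiable g x -> differentiable f (g x) ->
  'D_v (f \o g) x = 'D_('D_v g x) f (g x).
Proof.
move=> dg df; rewrite (deriveE v dg) (deriveE _ df) deriveE.
  by rewrite diff_comp.
exact: differentiable_comp.
Qed.

Lemma derive_pair (R : realType) (U V W : normedModType R) (f : U -> V)
    (g : U -> W) x v : differentiable f x -> differentiable g x ->
  'D_v (fun z => (f z, g z)) x = ('D_v f x, 'D_v g x).
Proof.
move=> df dg; rewrite (deriveE _ df) (deriveE _ dg) deriveE ?diff_pair //.
exact: differentiable_pair.
Qed.

Lemma derive_linear (R : realType) (U V W : normedModType R)
    (f : {linear V -> W}) (g : U -> V) x v : continuous f ->
  differentiable g x -> 'D_v (fun z => f (g z)) x = f ('D_v g x).
Proof.
move=> cf dg; have df := linear_differentiable (g x) cf.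
by rewrite (derive_comp (f := f)) // deriveE // diff_lin.
Qed.

Lemma derive_cV (R : realType) n (W : normedModType R) (f : 'cV[R]_n -> W) x v :
  differentiable f x -> 'D_v f x = \sum_j v j 0 *: 'D_(delta_mx j 0) f x.
Proof.
move=> df; rewrite deriveE // [in LHS](matrix_sum_delta v) linear_sum /=.
apply: eq_bigr => i _; rewrite big_ord1 linearZ /=; congr (_ *: _).
by rewrite deriveE.
Qed.

Lemma jacE (R : realType) n m (f : 'cV[R]_n -> 'cV[R]_m) x v :
  differentiable f x -> jac f x *m v = 'D_v f x.
Proof.
move=> df; rewrite derive_cV //; apply/colP => i; rewrite !mxE summxE.
by apply: eq_bigr => j _; rewrite !mxE mulrC.
Qed.

Lemma dot_gradl (R : realType) n (f : 'cV[R]_n -> R) x v :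
  differentiable (f : _ -> R^o) x -> dot (grad f x) v = 'D_v (f : _ -> R^o) x.
Proof.
move=> df; rewrite derive_cV // /dot mxE; apply: eq_bigr => j _.
by rewrite !mxE mulrC.
Qed.

(** * Differentiability by explicit error bounds *)

Section DiffEps.
Context {R : realType} {V W : normedModType R}.

Lemma differentiable_eps (f : V -> W) x : differentiable f x ->
  forall e : R, 0 < e ->
    \forall h \near (0 : V), `|f (h + x) - f x - 'D_h f x| <= e * `|h|.
Proof.
move=> df e e0; have /diff_locally/eqaddoP/(_ _ e0) := df.
by apply: filterS => h /=; rewrite deriveE // -![(_ + _ : _ -> _) _]/(_ + _)
  -![(- _ : _ -> _) _]/(- _) /cst /= opprD addrA.
Qed.

(** Turns an error bound into differentiability together with the value of the differential. The
    implicit function is differentiated this way, its candidate derivative being known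
    beforehand. *)
Lemma eps_differentiable (f : V -> W) (l : {linear V -> W}) x :
  continuous l ->
  (forall e : R, 0 < e ->
    \forall h \near (0 : V), `|f (h + x) - f x - l h| <= e * `|h|) ->
  differentiable f x /\ 'd f x = l :> (V -> W).
Proof.
move=> cl h.
have E : f \o shift x = cst (f x) + l +o_ 0 id.
  apply/eqaddoP => e /h; apply: filterS => z.
  by rewrite -![(_ + _ : _ -> _) _]/(_ + _)
  -![(- _ : _ -> _) _]/(- _) /cst /= opprD addrA.
have D := diff_unique cl E.
by split=> //; apply/diff_locallyP; rewrite D.
Qed.

Lemma near_eq_differentiable (f g : V ->
  W) x : (\forall z \near x, f z = g z) ->
  differentiable f x -> differentiable g x.
Proof.
move=> fg df.
suff [] : differentiable g x /\ 'd g x = 'd f x :> (V -> W) by [].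
apply: eps_differentiable => [|e e0]; first exact: diff_continuous.
have fgx := nbhs_singleton fg.
have fg0 : \forall h \near (0 : V), f (h + x) = g (h + x).
  move: fg; rewrite (near_shift 0 x) /=; apply: filterS => z /=.
  by rewrite subr0.
near=> h; rewrite -fgx -(near fg0 h) // -deriveE //.
by near: h; exact: differentiable_eps.
Unshelve. all: end_near. Qed.

End DiffEps.

(** * Closure properties of maps of class C^k *)

Section Ck.
Context {R : realType} {V : normedModType R}.
Implicit Types (A B : set V).

(** As [A] is open, the equality holds near each point and so passes to directional derivatives,
    which lets the induction run. Later lemmas use it to replace a derivative by its formula. *)
Lemma Ck_ext (W : normedModType R) k A (f g : V -> W) : open A ->
  (forall x, A x -> f x = g x) -> Ck k A f -> Ck k A g.
Proof.
move=> oA; elim: k f g => [|k IH] f g fg /=.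
  move=> cf x Ax; rewrite /prop_for /continuous_at -(fg _ Ax);
    apply: cvg_trans (cf x Ax).
  apply: near_eq_cvg; near=> z; apply: fg; near: z.
  exact: open_nbhs_nbhs.
have E x : A x -> \forall z \near x, f z = g z.
  by move=> Ax; near=> z; apply: fg; near: z; exact: open_nbhs_nbhs.
move=> [df Cf]; split=> [x Ax|v].
  by apply: near_eq_differentiable (df x Ax); exact: E.
by apply: IH (Cf v) => x Ax; apply: near_eq_derive; exact: E.
Unshelve. all: end_near. Qed.

Lemma CkS (W : normedModType R) k A (f : V -> W) : Ck k.+1 A f -> Ck k A f.
Proof.
elim: k f => [|k IH] f [df Cf]; first by move=> x /df/differentiable_continuous.
by split=> // v; apply: IH.
Qed.

Lemma Ck_sub (W : normedModType R) k A B (f : V -> W) : A `<=` B ->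
  Ck k B f -> Ck k A f.
Proof.
move=> AB; elim: k f => [|k IH] f /=; first by move=> cf x /AB/cf.
by move=> [df Cf]; split=> [x /AB/df//|v]; apply: IH.
Qed.

Lemma Ck_cst (W : normedModType R) k A (c : W) : Ck k A (fun=> c).
Proof.
elim: k c => [|k IH] c /=; first by move=> x _; exact: cst_continuous.
split=> [x _|v]; first exact: differentiable_cst.
by rewrite (_ : 'D_v _ = fun=> 0) //; apply/funext => x; exact: derive_cst.
Qed.

Section Open.
Context {A : set V} (oA : open A).

Lemma CkD (W : normedModType R) k (f g : V -> W) :
  Ck k A f -> Ck k A g -> Ck k A (fun z => f z + g z).
Proof.
elim: k f g => [|k IH] f g /=.
  by move=> cf cg x Ax; apply: cvgD; [exact: cf|exact: cg].
move=> [df Cf] [dg Cg]; split=> [x Ax|v].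
  by apply: differentiableD; [exact: df|exact: dg].
apply: Ck_ext oA _ (IH _ _ (Cf v) (Cg v)) => x Ax.
by rewrite -deriveD //; apply: diff_derivable; [exact: df|exact: dg].
Qed.

(** The product rule contains [f] and [g] next to their derivatives; [CkS] lowers their order so
    that the induction hypothesis applies. *)
Lemma CkM k (f g : V -> R^o) :
  Ck k A f -> Ck k A g -> Ck k A (fun z => f z * g z : R^o).
Proof.
elim: k f g => [|k IH] f g.
  by move=> cf cg x Ax; apply: cvgM; [exact: cf|exact: cg].
move=> Cf' Cg'; have [df Cf] := Cf'; have [dg Cg] := Cg'.
split=> [x Ax|v].
  by apply: differentiableM; [exact: df|exact: dg].
apply: Ck_ext oA _ (CkD (IH _ _ (CkS Cf') (Cg v)) (IH _ _ (CkS Cg') (Cf v))).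
move=> x Ax; rewrite /= (_ : (fun z => _) = f * g) // deriveM //.
  by apply: diff_derivable; exact: df.
by apply: diff_derivable; exact: dg.
Qed.

Lemma Ck_linear (U W : normedModType R) k (L : {linear U -> W}) (f : V -> U) :
  continuous L -> Ck k A f -> Ck k A (fun z => L (f z)).
Proof.
move=> cL; elim: k f => [|k IH] f.
  by move=> cf x Ax; apply: cvg_comp; [exact: cf|exact: cL].
move=> [df Cf]; split=> [x Ax|v].
  apply: (@differentiable_comp _ _ _ _ f L); first exact: df.
  exact: linear_differentiable.
by apply: Ck_ext oA _ (IH _ (Cf v)) => x Ax; rewrite derive_linear //;
  exact: df.
Qed.

Lemma Ck_pair (U W : normedModType R) k (f : V -> U) (g : V -> W) :
  Ck k A f -> Ck k A g -> Ck k A (fun z => (f z, g z)).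
Proof.
elim: k f g => [|k IH] f g.
  by move=> cf cg x Ax; apply: cvg_pair; [exact: cf|exact: cg].
move=> [df Cf] [dg Cg]; split=> [x Ax|v].
  by apply: differentiable_pair; [exact: df|exact: dg].
apply: Ck_ext oA _ (IH _ _ (Cf v) (Cg v)) => x Ax.
by rewrite (derive_pair _ (df x Ax) (dg x Ax)).
Qed.

Lemma Ck_mx k m n (f : V -> 'M[R]_(m, n)) :
  (forall i j, Ck k A (fun z => f z i j : R^o)) -> Ck k A f.
Proof.
elim: k f => [|k IH] f Cf.
  move=> x Ax; apply/cvg_ballP => e e0.
  have : \forall z \near x, forall i j, ball (f x i j) e (f z i j).
    apply: filter_forall => i; apply: filter_forall => j.
    by move/cvg_ballP : (Cf i j x Ax) => /(_ e e0).
  by apply: filterS => z h; split.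
split=> [x Ax|v].
  by apply: differentiable_mx => i j; case: (Cf i j) => + _; apply.
apply: IH => i j; have [_ /(_ v)] := Cf i j.
apply: Ck_ext oA _ => x Ax; rewrite derive_entry //; apply: diff_derivable.
by apply: differentiable_mx => i' j'; case: (Cf i' j') => + _; apply.
Qed.

Lemma Ck_entry k m n (f : V -> 'M[R]_(m, n)) i j :
  Ck k A f -> Ck k A (fun z => f z i j : R^o).
Proof.
elim: k f => [|k IH] f.
  move=> cf x Ax; apply: (@continuous_comp _ _ _ f (fun M => M i j : R^o)).
    exact: cf.
  exact: coord_continuous.
move=> [df Cf]; split=> [x Ax|v].
  by apply: differentiable_entry; exact: df.
apply: Ck_ext oA _ (IH _ (Cf v)) => x Ax.
by rewrite derive_entry //; apply: diff_derivable; exact: df.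
Qed.

Lemma Ck_sum (W : normedModType R) k (T : Type) (r : seq T) (P : pred T)
    (f : T -> V -> W) :
  (forall i, Ck k A (f i)) -> Ck k A (fun z => \sum_(i <- r | P i) f i z).
Proof.
move=> Cf; elim: r => [|i r IH].
  by apply: Ck_ext oA _ (Ck_cst k A (0 : W)) => x _; rewrite big_nil.
case Pi: (P i); last by apply: Ck_ext oA _ IH => x _; rewrite big_cons Pi.
by apply: Ck_ext oA _ (CkD (Cf i) IH) => x _; rewrite big_cons Pi.
Qed.

Lemma Ck_prod k (T : Type) (r : seq T) (P : pred T) (f : T -> V -> R^o) :
  (forall i, Ck k A (f i)) -> Ck k A (fun z =>
    \prod_(i <- r | P i) f i z : R^o).
Proof.
move=> Cf; elim: r => [|i r IH].
  by apply: Ck_ext oA _ (Ck_cst k A (1 : R^o)) => x _; rewrite big_nil.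
case Pi: (P i); last by apply: Ck_ext oA _ IH => x _; rewrite big_cons Pi.
by apply: Ck_ext oA _ (CkM (Cf i) IH) => x _; rewrite big_cons Pi.
Qed.

Lemma Ck_mulmx k m n p (f : V -> 'M[R]_(m, n)) (g : V -> 'M[R]_(n, p)) :
  Ck k A f -> Ck k A g -> Ck k A (fun z => f z *m g z).
Proof.
move=> Cf Cg; apply: Ck_mx => i j; under eq_fun do rewrite mxE.
by apply: Ck_sum => l; apply: CkM; apply: Ck_entry.
Qed.

(** The derivative is [- f^-1 * f^-1 * 'D_v f], in which [f^-1] is needed to order [k] only, as the
    induction provides. *)
Lemma CkV k (f : V -> R^o) : (forall x, A x -> f x != 0) ->
  Ck k A f -> Ck k A (fun z => (f z)^-1 : R^o).
Proof.
move=> f0; elim: k => [|k IH].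
  by move=> cf x Ax; apply: cvgV; [exact: f0|exact: cf].
move=> Cf'; have [df Cf] := Cf'; split=> [x Ax|v].
  by apply: differentiableV; [exact: df|exact: f0].
have CV := IH (CkS Cf').
apply: Ck_ext oA _ (CkM (Ck_cst k A (-1 : R^o)) (CkM (CkM CV CV) (Cf v))) =>
  x Ax.
rewrite deriveV ?f0 //; last by apply: diff_derivable; exact: df.
by rewrite mulN1r scaleNr /= expr2 invfM.
Qed.

Lemma Ck_det k n (f : V -> 'M[R]_n) : Ck k A f ->
  Ck k A (fun z => \det (f z) : R^o).
Proof.
move=> Cf; apply: Ck_sum => s; apply: CkM; first exact: Ck_cst.
by apply: Ck_prod => i; exact: Ck_entry.
Qed.

(** Cramer's formula reduces the inverse to determinants and one scalar division. *)
Lemma Ck_invmx k n (f : V -> 'M[R]_n) : (forall x, A x -> f x \in unitmx) ->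
  Ck k A f -> Ck k A (fun z => invmx (f z)).
Proof.
move=> fU Cf.
apply: (@Ck_ext _ _ _ (fun z => (\det (f z))^-1 *: \adj (f z))) => //.
  by move=> x Ax; rewrite /invmx fU.
apply: Ck_mx => i j; under eq_fun do rewrite !mxE /cofactor.
apply: CkM; first apply: CkV; last 1 first.
- apply: CkM; first exact: Ck_cst.
  apply: Ck_det; apply: Ck_mx => i' j'; under eq_fun do rewrite !mxE.
  exact: Ck_entry.
- by move=> x Ax; rewrite -unitfE -unitmxE fU.
- exact: Ck_det.
Qed.

End Open.

End Ck.

(** In the chain rule the direction ['D_v g z] varies with [z], which the induction hypothesis does
    not allow. Expanding it along the standard basis moves the variation into scalar coefficients;
    this is why the middle space consists of column vectors. *)
Lemma Ck_comp (R : realType) (V : normedModType R) n m p k (A : set V)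
    (B : set 'cV[R]_n) (f : 'cV[R]_n -> 'M[R]_(m, p)) (g : V -> 'cV[R]_n) :
  open A -> open B -> (forall x, A x -> B (g x)) ->
  Ck k B f -> Ck k A g -> Ck k A (f \o g).
Proof.
move=> oA oB gAB; elim: k f => [|k IH] f.
  move=> cf cg x Ax; apply: (@continuous_comp _ _ _ g f); first exact: cg.
  exact/cf/gAB.
move=> [df Cf] Cg'; have [dg Cg] := Cg'; split=> [x Ax|v].
  by apply: differentiable_comp; [exact: dg|exact/df/gAB].
have C : Ck k A (fun z => \sum_j
    ('D_v g z) j 0 *: ('D_(delta_mx j 0) f \o g) z).
  apply: Ck_sum => // j; apply: Ck_mx => // i l.
  under eq_fun do rewrite mxE.
  have C' := Ck_entry oA i l (IH _ (Cf (delta_mx j 0)) (CkS Cg')).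
  by apply: Ck_ext oA _ (CkM oA (Ck_entry oA j 0 (Cg v)) C') => x _.
apply: Ck_ext oA _ C => x Ax /=.
have dfx := df _ (gAB _ Ax); have dgx := dg x Ax.
by rewrite (derive_comp v dgx dfx) [RHS]derive_cV.
Qed.

(** * Symmetry of second derivatives *)

Section Schwarz.
Context {R : realType} {V : normedModType R}.

Lemma is_derive_line (W : normedModType R) (f : V -> W) u z (a : R) :
  differentiable f (a *: u + z) ->
  is_derive (a : R^o) (1 : R^o) (fun s : R^o => f (s *: u + z))
    ('D_u f (a *: u + z)).
Proof.
move=> df; have dl : is_derive (a : R^o) (1 : R^o) (fun s : R^o =>
  s *: u + z) u.
  have dl : is_diff (a : R^o) (fun s : R^o => s *: u + z) (fun s => s *: u).
    by apply: is_diff_eq; apply/funext => s; rewrite /= addr0.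
  apply: DeriveDef; first exact: diff_derivable.
  by rewrite deriveE // diff_val scale1r.
have dl' : differentiable (fun s : R^o => s *: u + z) (a : R^o).
  by apply/derivable1_diffP.
have E := derive_comp (f := f) (1 : R^o) dl' df.
rewrite derive_val in E; rewrite -E.
by apply: is_derive_diff; exact: differentiable_comp.
Qed.

(** The mean value theorem twice: along [u] for the difference of [f] over the step [h *: v], then
    along [v] for ['D_u f]. *)
Lemma second_difference (f : V -> R^o) x u v (h : R) (A : set V) : 0 < h ->
  (forall a b, 0 <= a <= h -> 0 <= b <= h -> A (a *: u + (b *: v + x))) ->
  (forall z, A z -> differentiable f z) ->
  (forall z, A z -> differentiable ('D_u f) z) ->
  exists a b, [/\ 0 <= a <= h, 0 <= b <= h &
    f (h *: u + (h *: v + x)) - f (h *: u + x) - f (h *: v + x) + f x =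
    h * h * 'D_v ('D_u f) (a *: u + (b *: v + x))].
Proof.
move=> h0 hA df ddf; have hh : 0 <= h <= h by rewrite lexx ltW.
have h00 : (0 : R) <= 0 <= h by rewrite lexx ltW.
pose p (a : R^o) : R^o := f (a *: u + (h *: v + x)) - f (a *: u + x).
have dp (a : R) : 0 <= a <= h -> is_derive (a : R^o) (1 : R^o) p
    ('D_u f (a *: u + (h *: v + x)) - 'D_u f (a *: u + x)).
  move=> ah; apply: is_deriveB; apply: is_derive_line; apply: df;
    first exact: hA.
  by have := hA _ _ ah h00; rewrite scale0r add0r.
have [|||a ah pE] := @MVT_segment R p
    (fun a : R => 'D_u f (a *: u + (h *: v + x)) - 'D_u f (a *: u + x)) 0 h.
- exact: ltW.
- by move=> a ah; apply: dp; rewrite !ltW // (itvP ah).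
- by apply: derivable_within_continuous => a ah;
    apply: ex_derive; apply: dp; rewrite !(itvP ah).
have {}ah : 0 <= a <= h by rewrite !(itvP ah).
pose q (b : R^o) : R^o := 'D_u f (b *: v + (a *: u + x)).
have dq (b : R) : 0 <= b <= h -> is_derive (b : R^o) (1 : R^o) q
    ('D_v ('D_u f) (b *: v + (a *: u + x))).
  move=> bh; apply: is_derive_line; apply: ddf.
  by rewrite addrCA; exact: hA.
have [|||b bh qE] := @MVT_segment R q
    (fun b : R => 'D_v ('D_u f) (b *: v + (a *: u + x))) 0 h.
- exact: ltW.
- by move=> b bh; apply: dq; rewrite !ltW // (itvP bh).
- by apply: derivable_within_continuous => b bh;
    apply: ex_derive; apply: dq; rewrite !(itvP bh).
have {}bh : 0 <= b <= h by rewrite !(itvP bh).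
exists a, b; split => //.
move: pE qE; rewrite /p /q !scale0r !add0r !subr0 !(addrCA (_ *: v)) => pE qE.
rewrite qE in pE; rewrite -addrA (addrC (- _) (f x)) -[f x - _]opprB pE.
by rewrite mulrC mulrA mulrAC.
Qed.

(** The two functions may agree at different points [p] and [q], as happens with two separate uses
    of the mean value theorem; continuity at [x] is enough to conclude. *)
Lemma eq_of_near_coincidence (F G : V -> R^o) (A : set V) x : open A -> A x ->
  {for x, continuous F} -> {for x, continuous G} ->
  (forall r : R, 0 < r -> ball x r `<=` A ->
     exists p q, [/\ ball x r p, ball x r q & F p = G q]) ->
  F x = G x.
Proof.
move=> oA Ax /cvgrPdist_lt cF /cvgrPdist_lt cG FG.
apply/eqP; rewrite -subr_eq0 -normr_le0; apply/ler_addgt0Pr => e e0.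
have e20 : 0 < e / 2 by rewrite divr_gt0.
have : \forall z \near x, [/\ `|F x - F z| < e / 2, `|G x - G z| < e / 2 & A z].
  apply: filterS3 (cF _ e20) (cG _ e20) (open_nbhs_nbhs (conj oA Ax)) =>
    z h1 h2 h3.
  by split.
move=> /nbhs_ballP[r /= r0 xr].
have [|p [q [xp xq E]]] := FG r r0; first by move=> z /xr[].
have [n1 _ _] := xr _ xp; have [_ n2 _] := xr _ xq.
rewrite add0r (splitr e) -(subrKA (F p)) (le_trans (ler_normD _ _)) //.
by rewrite lerD ?(ltW n1) // E distrC ltW.
Qed.

Lemma derive_sym_scalar (f : V -> R^o) (A : set V) x u v : open A -> A x ->
  Ck 2 A f -> 'D_u ('D_v f) x = 'D_v ('D_u f) x.
Proof.
move=> oA Ax [df Cf]; have [du Cu] := Cf u; have [dv Cv] := Cf v.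
apply: (eq_of_near_coincidence oA Ax (Cv u x Ax) (Cu v x Ax)) => r r0 rA.
(* The step [h] is chosen so that the parallelogram spanned by [h *: u] and [h *: v] stays within
   [r / 2] of [x]; the summand 1 keeps [k] positive when both directions vanish. *)
pose k := `|u| + `|v| + 1.
have k0 : 0 < k by rewrite ltr_pwDr // addr_ge0.
pose h := r / 2 / k; have h0 : 0 < h by rewrite !divr_gt0.
have hr a b : 0 <= a <= h -> 0 <= b <= h -> ball x r (a *: u + (b *: v + x)).
  move=> /andP[a0 ah] /andP[b0 bh]; rewrite -ball_normE /=.
  rewrite addrA opprD addrCA subrr addr0 normrN.
  apply: le_lt_trans (ler_normD _ _) _.
  rewrite !normrZ (ger0_norm a0) (ger0_norm b0).
  apply: (@le_lt_trans _ _ (h * k)).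
    rewrite /k !mulrDr mulr1 -[leLHS]addr0.
    apply: lerD (ltW h0).
    by apply: lerD; apply: ler_wpM2r.
  by rewrite /h divfK ?gt_eqF // ltr_pdivrMr // mulr_natr mulr2n ltrDl.
have hr' a b : 0 <= a <= h -> 0 <= b <= h -> ball x r (a *: v + (b *: u + x)).
  by move=> ah bh; rewrite addrCA; exact: hr.
(* Both mixed derivatives are values of the same second difference. *)
have [a [b [ah bh E1]]] := second_difference h0 hr
  (fun z rz => df z (rA z rz)) (fun z rz => du z (rA z rz)).
have [a' [b' [ah' bh' E2]]] := second_difference h0 hr'
  (fun z rz => df z (rA z rz)) (fun z rz => dv z (rA z rz)).
exists (a' *: v + (b' *: u + x)), (a *: u + (b *: v + x)).
split; [exact: hr'|exact: hr|].
apply: (@mulfI _ (h * h)); first by rewrite mulf_neq0 // gt_eqF.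
apply: etrans (esym E2) _; apply: etrans E1.
by rewrite (addrCA (h *: v)); congr (_ + _); exact: addrAC.
Qed.

Lemma derive_sym m n (f : V -> 'M[R]_(m, n)) (A : set V) x u v :
  open A -> A x -> Ck 2 A f -> 'D_u ('D_v f) x = 'D_v ('D_u f) x.
Proof.
move=> oA Ax Cf; have [df Cdf] := Cf.
have dA w z : A z -> derivable f z w by move=> /df; exact: diff_derivable.
have ddA w w' : derivable ('D_w f) x w'.
  by apply: diff_derivable; have [+ _] := Cdf w; exact.
apply/matrixP => i j.
have E w w' : ('D_w ('D_w' f) x) i j = 'D_w ('D_w' (fun z => f z i j : R^o)) x.
  apply: etrans (derive_entry i j (ddA w' w)) _.
  apply: near_eq_derive; near=> z; apply: derive_entry; apply: dA.
  by near: z; exact: open_nbhs_nbhs.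
apply: etrans (E u v) _; apply: etrans (esym (E v u)).
exact: derive_sym_scalar oA Ax (Ck_entry oA i j Cf).
Unshelve. all: end_near. Qed.

End Schwarz.

(** * Implicit functions of one variable *)

Section SupNorm.
Context {R : realType}.

Lemma entry_le_norm m n (M : 'M[R]_(m, n)) i j : `|M i j| <= `|M|.
Proof.
rewrite [leRHS]/Num.Def.normr /= mx_normrE.
exact: (le_bigmax _ (fun ij : 'I_m * 'I_n => `|M ij.1 ij.2|) (i, j)).
Qed.

Lemma norm_le_entries m n (M : 'M[R]_(m, n)) c :
  0 <= c -> (forall i j, `|M i j| <= c) -> `|M| <= c.
Proof.
move=> c0 h; by rewrite /Num.Def.normr /= mx_normrE bigmax_le // => -[i j] _;
  exact: h.
Qed.

Lemma norm_mulmx m n p (M : 'M[R]_(m, n)) (N : 'M[R]_(n, p)) :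
  `|M *m N| <= n%:R * (`|M| * `|N|).
Proof.
apply: norm_le_entries => [|i j]; first by rewrite !mulr_ge0.
rewrite mxE; apply: le_trans (ler_norm_sum _ _ _) _.
rewrite (_ : n%:R * _ = \sum_(k < n) `|M| * `|N|); last first.
  by rewrite sumr_const card_ord mulr_natl.
by apply: ler_sum => k _; rewrite normrM ler_pM // entry_le_norm.
Qed.

Lemma fixed_point_closed_ball k (r : R) (T : 'cV[R]_k -> 'cV[R]_k) : 0 < r ->
  (forall w, `|w| <= r -> `|T w| <= r) ->
  (forall w w', `|w| <= r -> `|w'| <= r -> `|T w - T w'| <= 2^-1 * `|w - w'|) ->
  exists2 w, `|w| <= r & T w = w.
Proof.
move=> r0 Tr Tc.
(* Matrices carry a complete and a normed structure, but not their join. *)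
pose X : completeNormedModType R :=
  HB.pack 'cV[R]_k (NormedModule.class 'cV[R]_k) (Complete.class 'cV[R]_k).
pose U : set X := [set w | `|w| <= r].
have TU : {homo (T : X -> X) : x / U x >-> U x} by move=> w; exact: Tr.
have ctr : is_contraction (mkfun_fun TU).
  exists (2^-1)%:nng; split; first by rewrite /= invf_lt1 // ltr1n.
  by move=> [w w'] [/= Uw Uw']; exact: Tc.
have clU : closed U.
  rewrite (_ : U = closed_ball (0 : X) r); first exact: closed_ball_closed.
  by rewrite closed_ballE //; apply/seteqP; split => w;
    rewrite /U /closed_ball_ /= sub0r normrN.
have [|w Uw wE] := banach_fixed_point ctr clU; last by exists w.
by exists 0; rewrite /U /= normr0 ltW.
Qed.

End SupNorm.

Lemma Ck_jac (R : realType) n m k (A : set 'cV[R]_n) (f : 'cV[R]_n ->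
  'cV[R]_m) :
  open A -> Ck k.+1 A f -> Ck k A (jac f).
Proof.
move=> oA [_ Cf]; apply: Ck_mx => // i j.
apply: Ck_ext oA _ (Ck_entry oA i 0 (Cf (delta_mx j 0))) => x _.
by rewrite mxE.
Qed.

(** The intermediate point depends on the entry [i], so there is no vector version. In the sup norm,
    bounds entry by entry suffice. *)
Lemma mean_value_entry (R : realType) n m (f : 'cV[R]_n -> 'cV[R]_m)
    (v z : 'cV[R]_n) i :
  (forall x, differentiable f x) ->
  exists2 a : R, 0 <= a <= 1 &
    (f (v + z) - f z) i 0 = ('D_v f (a *: v + z)) i 0.
Proof.
move=> df; pose p (s : R^o) : R^o := f (s *: v + z) i 0.
have dp (s : R) : is_derive (s : R^o) (1 : R^o) p (('D_v f (s *: v + z)) i 0).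
  exact: is_derive_entry i 0 (is_derive_line (df (s *: v + z))).
have [||a a01] := @MVT_segment R p (fun s : R => ('D_v f (s *: v + z)) i 0) 0 1.
- exact: ler01.
- by apply: derivable_within_continuous => s s01; apply: ex_derive; exact: dp.
rewrite /p scale1r scale0r add0r subr0 mulr1 => E.
exists a; last by rewrite -E !mxE.
by rewrite !(itvP a01).
Qed.

Lemma unitmx_injective (F : fieldType) k (M : 'M[F]_k) :
  (forall u : 'cV[F]_k, M *m u = 0 -> u = 0) -> M \in unitmx.
Proof.
move=> Minj; rewrite -unitmx_tr -row_free_unit -kermx_eq0.
apply/eqP/row_matrixP => i; rewrite row0; apply: trmx_inj; rewrite trmx0.
apply: Minj; apply: trmx_inj; rewrite trmx_mul trmxK trmx0.
by rewrite -row_mul mulmx_ker row0.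
Qed.

Lemma derive_scale1 (R : realType) (W : normedModType R) (f : R^o -> W) s t :
  differentiable f s -> 'D_t f s = t *: 'D_1 f s.
Proof. by move=> df; rewrite -deriveZv // [_ *: _]mulr1. Qed.

Lemma differentiable_local_lipschitz (R : realType) (W : normedModType R)
    (f : R^o -> W) s : differentiable f s ->
  exists2 K : R, 0 < K &
    \forall t \near (0 : R^o), `|f (t + s) - f s| <= K * `|t|.
Proof.
move=> df; exists (`|'D_1 f s| + 1); first by rewrite ltr_pwDr.
have := differentiable_eps df ltr01; apply: filterS => t.
rewrite (derive_scale1 t df).
move=> h; rewrite -[X in `|X|](subrK (t *: 'D_1 f s)).
rewrite (le_trans (ler_normD _ _)) // addrC mulrDl lerD //.
by rewrite normrZ mulrC.
Qed.

Section ImplicitCurve.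
Context {R : realType} {n k : nat} (h : 'cV[R]_n -> 'cV[R]_k)
  (c : R^o -> 'cV[R]_n) (P : 'M[R]_(n, k)).
Context (h_smooth : smooth_on setT h) (c_smooth : smooth_on setT c)
  (h0 : h (c 0) = 0) (jacP : jac h (c 0) *m P = 1%:M).

Let dh x : differentiable h x.
Proof. by have [+ _] := h_smooth 1; exact. Qed.

Let dc x : differentiable c x.
Proof. by have [+ _] := c_smooth 1; exact. Qed.

Let near_identity : exists2 r : R, 0 < r & forall z (u :
  'cV[R]_k), ball (c 0) r z ->
  `|u - jac h z *m (P *m u)| <= 2^-1 * `|u|.
Proof.
have C : Ck 0 setT (fun z => jac h z *m P).
  apply: Ck_mulmx; first exact: openT.
    exact: Ck_jac openT (h_smooth 1).
  exact: Ck_cst.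
(* [norm_mulmx] costs a factor [k], to be brought below 1/2; the successor keeps [e] meaningful for
   [k = 0]. *)
pose e : R := (k.+1%:R * 2)^-1.
have e0 : 0 < e by rewrite invr_gt0 mulr_gt0.
have /cvgrPdist_lt/(_ _ e0)/nbhs_ballP[r /= r0 hr] := C (c 0) I.
exists r => // z u /hr; rewrite jacP => zr.
rewrite mulmxA -[X in `|X - _|]mul1mx -mulmxBl.
apply: le_trans (norm_mulmx _ _) _; rewrite mulrA ler_wpM2r //.
apply: (@le_trans _ _ (k.+1%:R * e)).
  by apply: ler_pM => //; [rewrite ler_nat|exact: ltW].
by rewrite /e invfM mulrA mulfV ?mul1r.
Qed.

(** In order: [w - h (c s + P *m w)] contracts by 1/2, the same holds infinitesimally, and the image
    of [w = 0] has norm at most [r / 2]. The radius [r] keeps [P *m w] below [e / 2] and [d] keeps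
    [c s] within [e / 2] of [c 0], so that [near_identity] applies throughout. *)
Let implicit_estimates : exists r d : R, [/\ 0 < r, 0 < d,
  forall (s : R) (w w' : 'cV[R]_k), `|s| < d -> `|w| <= r -> `|w'| <= r ->
    `|(w - w') - (h (c s + P *m w) - h (c s + P *m w'))| <= 2^-1 * `|w - w'|,
  forall (s : R) (w u : 'cV[R]_k), `|s| < d -> `|w| <= r ->
    `|u - jac h (c s + P *m w) *m (P *m u)| <= 2^-1 * `|u| &
  forall s : R, `|s| < d -> `|h (c s)| <= r / 2].
Proof.
have [e e0 he] := near_identity.
pose b : R := k%:R * `|P| + 1.
have b0 : 0 < b by rewrite ltr_pwDr // mulr_ge0.
pose r := e / 2 / b; have r0 : 0 < r by rewrite !divr_gt0.
have e20 : 0 < e / 2 by rewrite divr_gt0.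
have r20 : 0 < r / 2 by rewrite divr_gt0.
have Pr w : `|w| <= r -> `|P *m w| <= e / 2.
  move=> wr; apply: le_trans (norm_mulmx _ _) _; rewrite mulrA.
  apply: (@le_trans _ _ (b * r)); last by rewrite /r mulrC divfK ?gt_eqF.
  by apply: ler_pM => //; rewrite ?mulr_ge0 // lerDl.
have cc : {for 0, continuous c} by exact: differentiable_continuous.
have ch : {for 0, continuous (h \o c)}.
  by apply: continuous_comp => //; exact: differentiable_continuous.
have /nbhs_ballP[d1 /= d10 hd1] :
    \forall s \near (0 : R^o), `|c 0 - c s| < e / 2.
  by move/cvgrPdist_lt : cc; exact.
have /nbhs_ballP[d2 /= d20 hd2] :
    \forall s \near (0 : R^o), `|h (c 0) - h (c s)| < r / 2.
  by move/cvgrPdist_lt : ch; exact.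
have inb s w : `|s| < Num.min d1 d2 -> `|w| <= r ->
    ball (c 0) e (c s + P *m w).
  rewrite lt_min => /andP[sd _] wr; rewrite -ball_normE /= opprD addrA.
  apply: le_lt_trans (ler_normB _ _) _; rewrite (splitr e) ltr_leD ?Pr //.
  by apply: hd1; rewrite -ball_normE /= sub0r normrN.
exists r, (Num.min d1 d2); split=> //.
- by rewrite lt_min d10.
- move=> s w w' sd wr wr'; apply: norm_le_entries => [|i j];
  first exact: mulr_ge0.
  rewrite (ord1 j).
  have [a /andP[a0 a1] aE] :=
    mean_value_entry (P *m (w - w')) (c s + P *m w') i dh.
  have E : P *m (w - w') + (c s + P *m w') = c s + P *m w.
    by rewrite mulmxBr addrCA subrK.
  rewrite E in aE; set y := a *: _ + _ in aE.
  (* The intermediate point is again of the form [c s + P *m w''], where [w''] is a convex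
     combination and hence has norm at most [r]. *)
  have yE : y = c s + P *m (a *: w + (1 - a) *: w').
    rewrite /y addrCA scalemxAr -mulmxDr; congr (_ + _ *m _).
    by rewrite scalerBr scalerBl scale1r addrA addrAC.
  rewrite (_ : _ i 0 = ((w - w') - jac h y *m (P *m (w - w'))) i 0); last first.
    by rewrite [LHS]mxE [X in _ + X]mxE aE [RHS]mxE [X in _ = _ + X]mxE jacE.
  rewrite yE.
  apply: le_trans (entry_le_norm _ _ _) _; apply: he; apply: inb => //.
  apply: le_trans (ler_normD _ _) _; rewrite !normrZ !ger0_norm ?subr_ge0 //.
  apply: (@le_trans _ _ (a * r + (1 - a) * r)).
    by apply: lerD; apply: ler_wpM2l => //; rewrite subr_ge0.
  by rewrite -mulrDl addrC subrK mul1r.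
- by move=> s w u sd wr; apply: he; exact: inb.
- move=> s; rewrite lt_min => /andP[_ sd]; rewrite -normrN -sub0r -h0.
  by apply/ltW/hd2; rewrite -ball_normE /= sub0r normrN.
Qed.

(* [h (c s + P w) = 0] is the fixed point equation of [w |-> w - h (c s + P w)],
   a contraction near 0 since [dh P = 1] at [c 0].  Smoothness is bootstrapped
   from [w' = - (dh P)^-1 dh c']. *)
Lemma implicit_curve : exists (d : R) (w : R^o -> 'cV[R]_k), [/\ 0 < d,
  smooth_on (ball (0 : R^o) d) w, w 0 = 0 &
  forall s, ball (0 : R^o) d s -> h (c s + P *m w s) = 0].
Proof.
have [r [d [r0 d0 est jest hc]]] := implicit_estimates.
have sol (s : R^o) : exists w : 'cV[R]_k,
    `|s| < d -> `|w| <= r /\ h (c s + P *m w) = 0.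
  have [sd|] := boolP (`|s| < d); last by exists 0.
  have [|w w' wr wr'|w wr wE] := @fixed_point_closed_ball R k r
      (fun w => w - h (c s + P *m w)) r0.
  (* The ball is mapped into itself: the contraction estimate against [w' = 0] gives [r / 2], and
     the image of 0 another [r / 2]. *)
  - move=> w wr; have := est s w 0 sd wr; rewrite normr0 (ltW r0) => /(_ isT).
    rewrite mulmx0 addr0 subr0 => e1.
    have -> : w - h (c s + P *m w) = (w - (h (c s + P *m w) - h (c s))) - h (c
      s).
      by rewrite opprB (addrCA w) [h (c s) + _]addrC addrK.
    apply: le_trans (ler_normB _ _) _; rewrite (splitr r);
      apply: lerD (hc _ sd).
    by apply: le_trans e1 _; rewrite mulrC ler_wpM2r.
  - by rewrite opprD addrACA -opprD; exact: est.
  - exists w => _; split=> //; apply/eqP; rewrite -oppr_eq0.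
    by apply/eqP/(addrI w); rewrite addr0.
have {sol}[w wP] := choice sol.
have wr s : `|s| < d -> `|w s| <= r by move=> /wP[].
have hw s : `|s| < d -> h (c s + P *m w s) = 0 by move=> /wP[].
(* The residual at any [w'] bounds the distance from [w'] to the solution. This yields both
   [w 0 = 0] and the local Lipschitz bound for [w]. *)
have lip s w' : `|s| < d -> `|w'| <= r ->
    `|w s - w'| <= 2 * `|h (c s + P *m w')|.
  move=> sd wr'; have := est s (w s) w' sd (wr _ sd) wr'.
  rewrite hw // sub0r opprK => e1.
  have := ler_normB (w s - w' + h (c s + P *m w')) (h (c s + P *m w')).
  by rewrite addrK; lra.
pose Y (s : R^o) : 'cV[R]_n := c s + P *m w s.
have neard (s : R) : `|s| < d -> \forall t \near (0 : R^o), `|t + s| < d.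
  move=> sd; apply/nbhs_ballP; exists (d - `|s|); first by rewrite /= subr_gt0.
  move=> t; rewrite -ball_normE /= sub0r normrN ltrBrDr.
  exact/le_lt_trans/ler_normD.
(* A lower bound for [jac h (Y s) *m P]: it gives invertibility, and at the end it recovers the
   remainder of [w] from its image. *)
have jestU (s : R) (u : 'cV[R]_k) : `|s| < d ->
  `|u| <= 2 * `|jac h (Y s) *m (P *m u)|.
  move=> sd; have := jest s (w s) u sd (wr _ sd).
  rewrite -/(Y s); set v := jac h _ *m _ => e1.
  have := ler_normD (u - v) v; rewrite subrK; lra.
have jU (s : R) : `|s| < d -> jac h (Y s) *m P \in unitmx.
  move=> sd; apply: unitmx_injective => u; rewrite -mulmxA => u0.
  by have := jestU s u sd; rewrite u0 normr0 mulr0 normr_le0 => /eqP.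
pose dw (s : R^o) : 'cV[R]_k :=
  - (invmx (jac h (Y s) *m P) *m (jac h (Y s) *m 'D_1 c s)).
have wder (s : R^o) : `|s| < d ->
    differentiable w s /\ forall v : R^o, 'D_v w s = v *: dw s.
  move=> sd.
  have lind : linear (fun t : R^o => t *: dw s).
    by move=> x u v; rewrite scalerDl scalerA.
  pose lM := GRing.isLinear.Build _ _ _ _ _ lind.
  pose L : {linear R^o -> 'cV[R]_k} := HB.pack (fun t : R^o => t *: dw s) lM.
  suff [dws E] : differentiable w s /\ 'd w s = L :> (R^o -> _).
    by split=> // v; rewrite deriveE // E.
  apply: eps_differentiable => [|e e0]; first exact: scalel_continuous.
  have [Kc Kc0 hKc] := differentiable_local_lipschitz (dc s).
  pose q (x : R^o) := h (c x + P *m w s).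
  have dq : differentiable q s.
    have dcw : differentiable (fun x => c x + P *m w s) s.
      by apply: differentiableD; [exact: dc|exact: differentiable_cst].
    exact: (differentiable_comp dcw (dh _)).
  have [Kq Kq0 hKq] := differentiable_local_lipschitz dq.
  pose A := jac h (Y s).
  pose K := Kc + k%:R * (`|P| * (2 * Kq)).
  have K0 : 0 < K by rewrite ltr_pwDl // !mulr_ge0 // ltW.
  (* [e1] and [e2] make each of the two errors [h1] and [h2] below at most [e / 4] times the
     increment; the factor 2 of [jestU] then keeps their sum below [e]. *)
  pose e1 := e / 4 / (n%:R * `|A| + 1).
  have nA0 : 0 < n%:R * `|A| + 1 by rewrite ltr_pwDr // mulr_ge0.
  have e10 : 0 < e1 by rewrite !divr_gt0.
  pose e2 := e / 4 / K.
  have e20 : 0 < e2 by rewrite !divr_gt0.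
  have /nbhs_ballP[rho /= rho0 hrho] := differentiable_eps (dh (Y s)) e20.
  have nK : \forall t \near (0 : R^o), K * `|t| < rho.
    apply/nbhs_ballP; exists (rho / K); first by rewrite /= divr_gt0.
    by move=> t; rewrite -ball_normE /= sub0r normrN ltr_pdivlMr // mulrC.
  have ntd : \forall t \near (0 : R^o),
      `|c (t + s) - c s - 'D_t c s| <= e1 * `|t|.
    exact: (differentiable_eps (dc s) e10).
  near=> t; rewrite /=.
  have tsd : `|t + s| < d by near: t; exact: neard.
  have tK : K * `|t| < rho by near: t.
  have tc : `|c (t + s) - c s| <= Kc * `|t| by near: t.
  have tq : `|q (t + s) - q s| <= Kq * `|t| by near: t.
  have td : `|c (t + s) - c s - 'D_t c s| <= e1 * `|t|.
    by near: t.
  have qs : q s = 0 by exact: hw.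
  have tw : `|w (t + s) - w s| <= 2 * (Kq * `|t|).
    apply: le_trans (lip _ _ tsd (wr _ sd)) _; rewrite ler_pM2l //.
    by rewrite qs subr0 in tq.
  pose DY := Y (t + s) - Y s.
  have DYE : DY = (c (t + s) - c s) + P *m (w (t + s) - w s).
    by rewrite /DY /Y mulmxBr opprD addrACA.
  have DYK : `|DY| <= K * `|t|.
    rewrite DYE mulrDl; apply: le_trans (ler_normD _ _) _; apply: lerD => //.
    apply: le_trans (norm_mulmx _ _) _; rewrite -!mulrA ler_wpM2l //.
    by rewrite ler_wpM2l.
  have hDY : `|A *m DY| <= e2 * (K * `|t|).
    have : `|h (DY + Y s) - h (Y s) - 'D_DY h (Y s)| <= e2 * `|DY|.
      by apply: hrho; rewrite -ball_normE /= sub0r normrN (le_lt_trans DYK).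
    rewrite /DY subrK -/DY hw // hw // subrr sub0r normrN /A jacE //.
    by move=> h1; apply: le_trans h1 _; rewrite ler_wpM2l // ltW.
  set X := w (t + s) - w s - t *: dw s.
  (* The linear parts cancel by the choice of [dw]. What is left is [A *m DY], small because [h]
     vanishes at both ends of the increment, and the remainder of [c]. *)
  have XE : A *m (P *m X) = A *m DY - A *m (c (t + s) - c s - 'D_t c s).
    have AdW : A *m (P *m (t *: dw s)) = - (A *m 'D_t c s).
      rewrite mulmxA -scalemxAr /dw mulmxN mulmxA mulmxV ?jU // mul1mx.
      by rewrite (derive_scale1 t (dc s)) -scalemxAr scalerN.
    rewrite /X DYE; set dW := w _ - _; set dC := c _ - _.
    rewrite (mulmxBr P dW) (mulmxBr A (P *m dW)) AdW opprK.
    by rewrite (mulmxDr A dC) (mulmxBr A dC) opprB [RHS]addrC addrA subrK addrC.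
  apply: le_trans (jestU s X sd) _; rewrite -/A XE.
  have h1 : `|A *m (c (t + s) - c s - 'D_t c s)| <= e / 4 * `|t|.
    apply: le_trans (norm_mulmx _ _) _; rewrite mulrA.
    apply: (@le_trans _ _ ((n%:R * `|A| + 1) * (e1 * `|t|))).
      by apply: ler_pM => //; rewrite ?mulr_ge0 // lerDl.
    by rewrite mulrA /e1 [_ * (e / 4 / _)]mulrC divfK // gt_eqF.
  have h2 : `|A *m DY| <= e / 4 * `|t|.
    by apply: le_trans hDY _; rewrite mulrA /e2 divfK // gt_eqF.
  have h3 := ler_normB (A *m DY) (A *m (c (t + s) - c s - 'D_t c s)).
  by lra.
have oB : open (ball (0 : R^o) d) by exact: ball_open.
have inB s : ball (0 : R^o) d s -> `|s| < d.
  by rewrite -ball_normE /= sub0r normrN.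
exists d, w; split=> //.
- elim=> [|j IH].
    by move=> s /inB sd; apply: differentiable_continuous; case: (wder s sd).
  split=> [s /inB sd|v]; first by case: (wder s sd).
  have CY : Ck j (ball (0 : R^o) d) Y.
    apply: CkD => //; first exact: Ck_sub (@subsetT _ _) (c_smooth j).
    by apply: Ck_mulmx => //; exact: Ck_cst.
  have CA : Ck j (ball (0 : R^o) d) (jac h \o Y).
    apply: (@Ck_comp _ _ _ _ _ _ _ setT) => //; first exact: openT.
    exact: Ck_jac openT (h_smooth _).
  have Cdw : Ck j (ball (0 : R^o) d) (fun s => (- v)%:M *m
     (invmx ((jac h \o Y) s *m P) *m ((jac h \o Y) s *m 'D_1 c s))).
    apply: Ck_mulmx => //; first exact: Ck_cst.
    apply: Ck_mulmx => //.
      apply: Ck_invmx => //; first by move=> s /inB; exact: jU.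
      by apply: Ck_mulmx => //; exact: Ck_cst.
    apply: Ck_mulmx => //; have [_ /(_ 1)] := c_smooth j.+1.
    exact: Ck_sub.
  apply: Ck_ext oB _ Cdw => s /inB sd; have [_ ->] := wder s sd.
  by rewrite mul_scalar_mx scaleNr /dw scalerN.
- have d00 : `|0 : R| < d by rewrite normr0.
  have := lip 0 0 d00; rewrite normr0 (ltW r0) => /(_ isT).
  by rewrite mulmx0 addr0 h0 normr0 mulr0 normr_le0 subr0 => /eqP.
- by move=> s /inB; exact: hw.
Unshelve. all: end_near. Qed.

End ImplicitCurve.

(** * Quaternion and block matrix algebra *)

Section Quaternions.
Context {R : realType}.
Implicit Types x z : 'cV[R]_4.

Lemma dotE n (u v : 'cV[R]_n) : dot u v = \sum_i u i 0 * v i 0.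
Proof. by rewrite /dot mxE; apply: eq_bigr => i _; rewrite mxE. Qed.

Lemma dotC n (u v : 'cV[R]_n) : dot u v = dot v u.
Proof. by rewrite !dotE; apply: eq_bigr => i _; rewrite mulrC. Qed.

Lemma dotDl n (u v w : 'cV[R]_n) : dot (u + v) w = dot u w + dot v w.
Proof. by rewrite /dot linearD mulmxDl mxE. Qed.

Lemma dotDr n (u v w : 'cV[R]_n) : dot w (u + v) = dot w u + dot w v.
Proof. by rewrite /dot mulmxDr mxE. Qed.

Lemma dotNl n (u v : 'cV[R]_n) : dot (- u) v = - dot u v.
Proof. by rewrite /dot linearN mulNmx mxE. Qed.

Lemma dotNr n (u v : 'cV[R]_n) : dot u (- v) = - dot u v.
Proof. by rewrite dotC dotNl dotC. Qed.

Lemma dotZl n (u v : 'cV[R]_n) k : dot (k *: u) v = k * dot u v.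
Proof. by rewrite /dot linearZ -scalemxAl mxE. Qed.

Lemma dotZr n (u v : 'cV[R]_n) k : dot u (k *: v) = k * dot u v.
Proof. by rewrite dotC dotZl dotC. Qed.

Lemma dot0l n (u : 'cV[R]_n) : dot 0 u = 0.
Proof. by rewrite /dot trmx0 mul0mx mxE. Qed.

Lemma dot0r n (u : 'cV[R]_n) : dot u 0 = 0.
Proof. by rewrite dotC dot0l. Qed.

Lemma dot_mulmx m n (A : 'M[R]_(m, n)) u v : dot (A *m u) v = dot u (A^T *m v).
Proof. by rewrite /dot trmx_mul mulmxA. Qed.

Lemma dot_delta n j (v : 'cV[R]_n) : dot (delta_mx j 0) v = v j 0.
Proof.
rewrite dotE (bigD1 j) //= mxE !eqxx mul1r big1 ?addr0 // => i ij.
by rewrite mxE (negbTE ij) mul0r.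
Qed.

Lemma dot_inj n (u v : 'cV[R]_n) : (forall w, dot w u = dot w v) -> u = v.
Proof. by move=> h; apply/colP => j; rewrite -!dot_delta h. Qed.

Lemma dot_ge0 n (u : 'cV[R]_n) : 0 <= dot u u.
Proof. by rewrite dotE sumr_ge0 // => i _; exact: sqr_ge0. Qed.

Lemma dot_self_eq0 n (u : 'cV[R]_n) : dot u u = 0 -> u = 0.
Proof.
rewrite dotE => /eqP; rewrite psumr_eq0 => [/allP h|i _]; last exact: sqr_ge0.
apply/colP => i; rewrite mxE; apply/eqP.
by have := h i (mem_index_enum i); rewrite mulf_eq0 orbb.
Qed.

Lemma mulmx_ext m n (A B : 'M[R]_(m, n)) :
  (forall u : 'cV[R]_n, A *m u = B *m u) -> A = B.
Proof.
by move=> h; apply/matrixP => i j; have /colP/(_ i) := h (delta_mx j 0);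
  rewrite -!colE !mxE.
Qed.

(** Exposes the four coordinates in the form that [Hmat] uses, so that the identities below become
    polynomial ones for [ring]. *)
Lemma col4E x : x = \col_(j < 4)
  nth 0 [:: x (inord 0) 0; x (inord 1) 0; x (inord 2) 0; x (inord 3) 0] j.
Proof.
apply/colP => j; rewrite mxE.
have -> : j = inord j by rewrite inord_val.
by case: j => -[|[|[|[|]]]] //= h; rewrite inordK.
Qed.

Lemma Hmat_mulT x : Hmat x *m (Hmat x)^T = (dot x x)%:M.
Proof.
rewrite (col4E x); move: (x _ _) (x _ _) (x _ _) (x _ _) => a b c d.
apply/matrixP => -[[|[|[|//]]] i3] -[[|[|[|//]]] j3]; rewrite dotE !mxE;
  rewrite !big_ord_recl !big_ord0 !mxE !inordK //=; ring.
Qed.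

(** For a unit vector [x] this is the orthogonal projection onto the tangent space of the sphere at
    [x]. *)
Lemma Hmat_trmul x : (Hmat x)^T *m Hmat x = (dot x x)%:M - x *m x^T.
Proof.
rewrite (col4E x); move: (x _ _) (x _ _) (x _ _) (x _ _) => a b c d.
apply/matrixP => -[[|[|[|[|//]]]] i3] -[[|[|[|[|//]]]] j3]; rewrite dotE !mxE;
  rewrite !big_ord_recl !big_ord0 !mxE !inordK //=; ring.
Qed.

(** [Hmat x *m z] is the imaginary part of the quaternion product of the conjugate of [x] by [z].
    Conjugating that product exchanges [x] and [z] and changes the sign of its imaginary part. *)
Lemma Hmat_anticomm x z : Hmat x *m z = - (Hmat z *m x).
Proof.
rewrite (col4E x) (col4E z).
move: (x _ _) (x _ _) (x _ _) (x _ _) => a b c d.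
move: (z _ _) (z _ _) (z _ _) (z _ _) => a' b' c' d'.
apply/colP => -[[|[|[|//]]] i3]; rewrite !mxE;
  rewrite !big_ord_recl !big_ord0 !mxE !inordK //=; ring.
Qed.

Lemma Hmat_self x : Hmat x *m x = 0.
Proof.
have /colP E := Hmat_anticomm x x; apply/colP => i.
by have := E i; rewrite !mxE; lra.
Qed.

End Quaternions.

Section Blocks.
Context {R : realType} {nb : nat}.
Implicit Types (y z u v : 'cV[R]_(ydim nb)) (q d : 'cV[R]_(qdim nb)).

Lemma ycolE y : y = \mxcol_(i < nb) (col_mx (pos y i) (theta y i) :
  'cV[R]_(3 + 4)).
Proof.
by rewrite -[LHS]submxcolK; apply: eq_mxcol => i; rewrite vsubmxK.
Qed.

Lemma qcolE q : q = \mxcol_(i < nb) (col_mx (rpart q i) (apart q i) :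
  'cV[R]_(3 + 3)).
Proof.
by rewrite -[LHS]submxcolK; apply: eq_mxcol => i; rewrite vsubmxK.
Qed.

Lemma pos_mxcol (a : 'I_nb -> 'cV[R]_3) (b : 'I_nb -> 'cV[R]_4) i :
  pos (\mxcol_(i < nb) (col_mx (a i) (b i) : 'cV[R]_(3 + 4))) i = a i.
Proof. by rewrite /pos mxcolK col_mxKu. Qed.

Lemma theta_mxcol (a : 'I_nb -> 'cV[R]_3) (b : 'I_nb -> 'cV[R]_4) i :
  theta (\mxcol_(i < nb) (col_mx (a i) (b i) : 'cV[R]_(3 + 4))) i = b i.
Proof. by rewrite /theta mxcolK col_mxKd. Qed.

Lemma rpart_mxcol (a b : 'I_nb -> 'cV[R]_3) i :
  rpart (\mxcol_(i < nb) (col_mx (a i) (b i) : 'cV[R]_(3 + 3))) i = a i.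
Proof. by rewrite /rpart mxcolK col_mxKu. Qed.

Lemma apart_mxcol (a b : 'I_nb -> 'cV[R]_3) i :
  apart (\mxcol_(i < nb) (col_mx (a i) (b i) : 'cV[R]_(3 + 3))) i = b i.
Proof. by rewrite /apart mxcolK col_mxKd. Qed.

Lemma y_ext y z : (forall i, pos y i = pos z i) ->
  (forall i, theta y i = theta z i) -> y = z.
Proof.
move=> hp ht; rewrite (ycolE y) (ycolE z); apply: eq_mxcol => i.
by rewrite hp ht.
Qed.

Lemma q_ext q d : (forall i, rpart q i = rpart d i) ->
  (forall i, apart q i = apart d i) -> q = d.
Proof.
move=> hp ht; rewrite (qcolE q) (qcolE d); apply: eq_mxcol => i.
by rewrite hp ht.
Qed.

Lemma posD u v i : pos (u + v) i = pos u i + pos v i.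
Proof. by apply/colP => j; rewrite !mxE. Qed.
Lemma thetaD u v i : theta (u + v) i = theta u i + theta v i.
Proof. by apply/colP => j; rewrite !mxE. Qed.
Lemma posN u i : pos (- u) i = - pos u i.
Proof. by apply/colP => j; rewrite !mxE. Qed.
Lemma thetaN u i : theta (- u) i = - theta u i.
Proof. by apply/colP => j; rewrite !mxE. Qed.
Lemma rpartZ k d i : rpart (k *: d) i = k *: rpart d i.
Proof. by apply/colP => j; rewrite !mxE. Qed.
Lemma apartZ k d i : apart (k *: d) i = k *: apart d i.
Proof. by apply/colP => j; rewrite !mxE. Qed.
Lemma rpartN d i : rpart (- d) i = - rpart d i.
Proof. by apply/colP => j; rewrite !mxE. Qed.
Lemma apartN d i : apart (- d) i = - apart d i.
Proof. by apply/colP => j; rewrite !mxE. Qed.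
Lemma rpartB q d i : rpart (q - d) i = rpart q i - rpart d i.
Proof. by apply/colP => j; rewrite !mxE. Qed.
Lemma apartB q d i : apart (q - d) i = apart q i - apart d i.
Proof. by apply/colP => j; rewrite !mxE. Qed.

Lemma dot_ycol u v : dot u v =
  \sum_i (dot (pos u i) (pos v i) + dot (theta u i) (theta v i)).
Proof.
rewrite {1}(ycolE u) {1}(ycolE v) /dot tr_mxcol mul_mxrow_mxcol summxE.
by apply: eq_bigr => i _; rewrite tr_col_mx mul_row_col mxE.
Qed.

Lemma dot_qcol q d : dot q d =
  \sum_i (dot (rpart q i) (rpart d i) + dot (apart q i) (apart d i)).
Proof.
rewrite {1}(qcolE q) {1}(qcolE d) /dot tr_mxcol mul_mxrow_mxcol summxE.
by apply: eq_bigr => i _; rewrite tr_col_mx mul_row_col mxE.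
Qed.

Lemma Hbig_mulE y v : Hbig y *m v = \mxcol_(i < nb)
  (col_mx (pos v i) (Hmat (theta y i) *m theta v i) : 'cV[R]_(3 + 3)).
Proof.
rewrite -[in LHS](submxcolK v) /Hbig mul_mxblock_mxrow; apply: eq_mxcol => i.
rewrite (bigD1 i) //= eqxx big1 ?addr0 => [|j ji].
  rewrite -[submxcol v i](@vsubmxK _ 3 4) mul_block_col mul1mx !mul0mx.
  by rewrite addr0 add0r.
by rewrite eq_sym (negbTE ji) mul0mx.
Qed.

Lemma rpart_Hbig y v i : rpart (Hbig y *m v) i = pos v i.
Proof. by rewrite Hbig_mulE rpart_mxcol. Qed.

Lemma apart_Hbig y v i : apart (Hbig y *m v) i = Hmat (theta y i) *m theta v i.
Proof. by rewrite Hbig_mulE apart_mxcol. Qed.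

Lemma trHbig_mulE y d : (Hbig y)^T *m d = \mxcol_(i < nb)
  (col_mx (rpart d i) ((Hmat (theta y i))^T *m apart d i) : 'cV[R]_(3 + 4)).
Proof.
apply: dot_inj => w; rewrite -dot_mulmx dot_qcol dot_ycol.
apply: eq_bigr => i _; rewrite rpart_Hbig apart_Hbig pos_mxcol theta_mxcol.
by rewrite dot_mulmx.
Qed.

Lemma pos_trHbig y d i : pos ((Hbig y)^T *m d) i = rpart d i.
Proof. by rewrite trHbig_mulE pos_mxcol. Qed.

Lemma theta_trHbig y d i :
  theta ((Hbig y)^T *m d) i = (Hmat (theta y i))^T *m apart d i.
Proof. by rewrite trHbig_mulE theta_mxcol. Qed.

Lemma Ebig_mulE m J d : Ebig m J *m d = \mxcol_(i < nb)
  (col_mx (m i *: rpart d i) (4 *: (J i *m apart d i)) : 'cV[R]_(3 + 3)).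
Proof.
rewrite {1}(qcolE d) /Ebig mul_mxdiag_mxcol; apply: eq_mxcol => i.
by rewrite mul_block_col !mul0mx addr0 add0r mul_scalar_mx scalemxAl.
Qed.

Lemma Ibig_mulE y1 y : Ibig y1 *m y = \mxcol_(i < nb)
  (col_mx 0 (dot (theta y1 i) (theta y1 i) *: theta y i) : 'cV[R]_(3 + 4)).
Proof.
rewrite {1}(ycolE y) /Ibig mul_mxdiag_mxcol; apply: eq_mxcol => i.
by rewrite mul_block_col !mul0mx addr0 add0r mul_scalar_mx.
Qed.

Definition on_spheres y := forall i, dot (theta y i) (theta y i) = 1.

Lemma Hbig_mul_tr y : on_spheres y -> Hbig y *m (Hbig y)^T = 1%:M.
Proof.
move=> y1; apply: mulmx_ext => d; rewrite mul1mx -mulmxA; apply: q_ext => i.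
  by rewrite rpart_Hbig pos_trHbig.
by rewrite apart_Hbig theta_trHbig mulmxA Hmat_mulT y1 mul1mx.
Qed.

Lemma trHbig_mul_tangent y v : on_spheres y ->
  (forall i, dot (theta y i) (theta v i) = 0) ->
    (Hbig y)^T *m (Hbig y *m v) = v.
Proof.
move=> y1 yv; apply: y_ext => i; first by rewrite pos_trHbig rpart_Hbig.
rewrite theta_trHbig apart_Hbig mulmxA Hmat_trmul y1 mulmxBl mul1mx -mulmxA.
rewrite (_ : (theta y i)^T *m theta v i = 0) ?mulmx0 ?subr0 //.
by apply/matrixP => a b; rewrite !ord1 [RHS]mxE -(yv i).
Qed.

Lemma trHbig_mul_acceleration y y1 y2 : on_spheres y ->
  (forall i, dot (theta y i) (theta y2 i) = - dot (theta y1 i) (theta y1 i)) ->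
  (Hbig y)^T *m (Hbig y *m y2) - Ibig y1 *m y = y2.
Proof.
move=> ys hy2; apply: y_ext => i.
  by rewrite posD posN pos_trHbig rpart_Hbig Ibig_mulE pos_mxcol subr0.
rewrite thetaD thetaN theta_trHbig apart_Hbig Ibig_mulE theta_mxcol.
rewrite mulmxA Hmat_trmul ys mulmxBl mul1mx -mulmxA.
rewrite (_ : (theta y i)^T *m theta y2 i = (dot (theta y i) (theta y2 i))%:M);
  last by apply/matrixP => a b; rewrite !ord1 [RHS]mxE.
by rewrite hy2 mul_mx_scalar scaleNr opprK addrK.
Qed.

Lemma Hbig_Ibig y y1 : Hbig y *m (Ibig y1 *m y) = 0.
Proof.
apply: q_ext => i.
  by rewrite rpart_Hbig Ibig_mulE pos_mxcol; apply/colP => j; rewrite !mxE.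
rewrite apart_Hbig Ibig_mulE theta_mxcol -scalemxAr Hmat_self scaler0.
by apply/colP => j; rewrite !mxE.
Qed.

(* [Hbig] is affine; this is its linear part, hence its derivative. *)
Definition Hrot y : 'M[R]_(qdim nb, ydim nb) := Hbig y - Hbig 0.

Lemma Hrot_mulE y v : Hrot y *m v = \mxcol_(i < nb)
  (col_mx 0 (Hmat (theta y i) *m theta v i) : 'cV[R]_(3 + 3)).
Proof.
apply: q_ext => i; rewrite /Hrot mulmxBl.
  by rewrite rpartB !rpart_Hbig subrr rpart_mxcol.
rewrite apartB !apart_Hbig apart_mxcol.
rewrite (_ : Hmat (theta 0 i) = 0) ?mul0mx ?subr0 //.
apply/matrixP => -[[|[|[|//]]] i3] -[[|[|[|[|//]]]] j3];
  by rewrite !mxE /= ?mxE ?oppr0.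
Qed.

Lemma Hrot_anticomm u v : Hrot u *m v = - (Hrot v *m u).
Proof.
apply: q_ext => i; rewrite ?rpartN ?apartN !Hrot_mulE.
  by rewrite !rpart_mxcol oppr0.
by rewrite !apart_mxcol Hmat_anticomm.
Qed.

Lemma Hrot_self u : Hrot u *m u = 0.
Proof.
have /colP E := Hrot_anticomm u u; apply/colP => i.
by have := E i; rewrite !mxE; lra.
Qed.

(** Read off from anticommutation: [Hrot u *m w] equals [- (Hrot w *m u)], which is visibly linear
    in [u]. *)
Fact Hrot_is_linear : linear (Hrot : 'cV[R]_(ydim nb) ->
  'M[R]_(qdim nb, ydim nb)).
Proof.
move=> k u v; apply: mulmx_ext => w.
rewrite [RHS]mulmxDl -scalemxAl !(Hrot_anticomm _ w) mulmxDr -scalemxAr.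
by rewrite opprD scalerN.
Qed.

(** The translational blocks of [Hrot] vanish, which removes the masses; the factor 4 is that of the
    inertia blocks of [Ebig]. *)
Lemma Hbig_Hrot_Ktilde m J y y1 :
  Hbig y *m ((Hrot y1)^T *m (Ebig m J *m (Hbig y *m y1))) = 4 *: Ktilde J y y1.
Proof.
have trE d : (Hrot y1)^T *m d = \mxcol_(i < nb)
    (col_mx 0 ((Hmat (theta y1 i))^T *m apart d i) : 'cV[R]_(3 + 4)).
  apply: dot_inj => w; rewrite -dot_mulmx dot_qcol dot_ycol.
  apply: eq_bigr => i _; rewrite Hrot_mulE rpart_mxcol apart_mxcol.
  by rewrite pos_mxcol theta_mxcol dot0l dot0r dot_mulmx.
apply: q_ext => i; rewrite ?rpartZ ?apartZ.
  by rewrite rpart_Hbig trE pos_mxcol /Ktilde rpart_mxcol scaler0.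
rewrite apart_Hbig trE theta_mxcol Ebig_mulE apart_mxcol apart_Hbig /Ktilde.
by rewrite apart_mxcol -!scalemxAr !mulmxA.
Qed.

Lemma Ebig_sym m J : (forall i, (J i)^T = J i) ->
  (Ebig m J)^T = Ebig m J :> 'M[R]_(qdim nb).
Proof.
move=> Js; rewrite /Ebig tr_mxdiag; apply: eq_mxdiag => i.
by rewrite tr_block_mx !trmx0 tr_scalar_mx linearZ /= Js.
Qed.

Lemma Ebig_posdef (m : 'I_nb -> R) J d : (forall i, 0 < m i) ->
  (forall i (w : 'cV[R]_3), w != 0 -> 0 < dot w (J i *m w)) ->
  dot d (Ebig m J *m d) = 0 -> d = 0.
Proof.
move=> m0 J0; rewrite dot_qcol.
have Jn i (w : 'cV[R]_3) : 0 <= dot w (J i *m w).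
  by have [->|/J0/ltW//] := eqVneq w 0; rewrite dot0l.
rewrite (eq_bigr (fun i => m i * dot (rpart d i) (rpart d i) +
    4 * dot (apart d i) (J i *m apart d i))); last first.
  by move=> i _; rewrite Ebig_mulE rpart_mxcol apart_mxcol !dotZr.
have t0 i : 0 <= m i * dot (rpart d i) (rpart d i).
  by rewrite mulr_ge0 ?dot_ge0 // ltW.
have t1 i : 0 <= 4 * dot (apart d i) (J i *m apart d i) by rewrite mulr_ge0.
move/eqP; rewrite psumr_eq0 => [/allP h|i _]; last exact: addr_ge0.
apply: q_ext => i; have := h i (mem_index_enum i) => /=;
    rewrite paddr_eq0 // => /andP[]; rewrite mulf_eq0 gt_eqF //= => /eqP r0;
    rewrite mulf_eq0 pnatr_eq0 /= => /eqP a0.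
  by rewrite (dot_self_eq0 r0); apply/colP => j; rewrite !mxE.
have [->|/(J0 i)] := eqVneq (apart d i) 0; first by apply/colP => j;
  rewrite !mxE.
by move/gt_eqF/eqP/(_ a0).
Qed.

End Blocks.

(** * The Euler-Lagrange expression in a chart *)

(** The block matrix is square, so injectivity is enough. Pairing the homogeneous first equation
    with [d] removes the multiplier because [B *m d = 0]; hence [d = 0], and full rank of [B] gives
    [lam = 0]. *)
Lemma saddle_point_system (R : realType) n l (E : 'M[R]_n) (B : 'M[R]_(l, n))
    (r1 : 'cV[R]_n) (r2 : 'cV[R]_l) :
  (forall d, dot d (E *m d) = 0 -> d = 0) -> \rank B = l ->
  exists! dl : 'cV[R]_n * 'cV[R]_l,
    E *m dl.1 + B^T *m dl.2 = r1 /\ B *m dl.1 = r2.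
Proof.
move=> E0 Bl; pose M := block_mx E B^T B 0.
have ME d lam : M *m col_mx d lam = col_mx (E *m d + B^T *m lam) (B *m d).
  by rewrite mul_block_col mul0mx addr0.
have MU : M \in unitmx.
  apply: unitmx_injective => u; rewrite -(vsubmxK u).
  move: (usubmx u) (dsubmx u) => d lam; rewrite ME -[0]col_mx0.
  move=> /eq_col_mx[h1 h2].
  have d0 : d = 0.
    apply: E0; have := congr1 (dot d) h1.
    by rewrite dotDr dot0r -dot_mulmx h2 dot0l addr0.
  have lam0 : lam = 0.
    move: h1; rewrite d0 mulmx0 add0r => h1; apply: trmx_inj; rewrite trmx0.
    apply: (row_free_inj (A := B)); first by rewrite /row_free Bl.
    by rewrite mul0mx -[LHS]trmxK trmx_mul trmxK h1 trmx0.
  by rewrite d0 lam0 col_mx0.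
pose u := invmx M *m col_mx r1 r2.
have uE : M *m u = col_mx r1 r2 by rewrite mulKVmx.
exists (usubmx u, dsubmx u); split => /=.
  by apply/eq_col_mx; rewrite -ME vsubmxK.
move=> [d lam] /= [h1 h2].
have -> : u = col_mx d lam by rewrite /u -h1 -h2 -ME mulKmx.
by rewrite col_mxKu col_mxKd.
Qed.

Section EulerLagrange.
Context {R : realType} {n k : nat} (G : 'cV[R]_n -> 'M[R]_n) (U : 'cV[R]_n -> R)
  (Phi : 'cV[R]_k -> 'cV[R]_n) (O : set 'cV[R]_k).
Context (oO : open O) (Phi_C2 : Ck 2 O Phi) (G_C1 : Ck 1 setT G)
  (G_sym : forall y, (G y)^T = G y)
  (U_diff : forall y, differentiable (U : _ -> R^o) y).

Definition chart_lagrangian q q1 : R :=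
  2^-1 * dot (jac Phi q *m q1) (G (Phi q) *m (jac Phi q *m q1)) - U (Phi q).

Lemma is_derive_half (V : normedModType R) (f c : V -> R^o) (df dc : R) x v :
  is_derive x v f df -> is_derive x v c dc ->
  is_derive x v (fun z => 2^-1 * f z - c z : R^o) (2^-1 * df - dc).
Proof. by move=> hf hc; exact: (is_deriveB (is_deriveZ (2^-1 : R) hf) hc). Qed.

(** The momentum in the chart is the pullback of the ambient momentum; symmetry of [G] absorbs the
    factor 1/2. *)
Lemma grad_velocity q v : grad (chart_lagrangian q) v =
  (jac Phi q)^T *m (G (Phi q) *m (jac Phi q *m v)).
Proof.
apply/colP => j; rewrite mxE -[RHS]dot_delta -dot_mulmx.
move: (delta_mx j 0) => u; set W := jac Phi q; set A := G (Phi q).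
have dW := is_derive_mulmxl W (is_derive_id v u).
have dAW := is_derive_mulmxl A dW.
have dL := is_derive_half (is_derive_dot dW dAW)
  (is_derive_cst (U (Phi q) : R^o) v u).
apply: etrans (@derive_val _ _ _ _ _ _ _ dL) _.
have As : A^T = A by exact: G_sym.
by rewrite subr0 [X in _ + X]dotC [X in _ + X]dot_mulmx As; lra.
Qed.

(** With [p] the ambient momentum, the time derivative of [(jac Phi)^T *m p] and the gradient in [q]
    both contain the term where the Jacobian itself is differentiated. The two copies agree by
    symmetry of the second derivatives of [Phi] and cancel, leaving a pullback. *)
Lemma euler_lagrange_chart (I : set R^o) (q : R^o -> 'cV[R]_k)
    (y : R^o -> 'cV[R]_n) t : open I -> I t -> (forall s, I s -> O (q s)) ->
  (forall s, I s -> y s = Phi (q s)) -> Ck 2 I q ->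
  derive1 (fun s => grad (chart_lagrangian (q s)) (derive1 q s)) t
    - grad (fun x => chart_lagrangian x (derive1 q t)) (q t) =
  (jac Phi (q t))^T *m ('D_1 (fun s : R^o => G (y s) *m 'D_1 y s) t
    - grad (fun x => 2^-1 * dot ('D_1 y t) (G x *m 'D_1 y t)) (y t)
    + grad U (y t)).
Proof.
move=> oI It qO yE Cq.
have nearI s : I s -> \forall x \near s, I x.
  by move=> Is; exact: open_nbhs_nbhs.
have nearO x : O x -> \forall z \near x, O z.
  by move=> Ox; exact: open_nbhs_nbhs.
have dPhi x : O x -> differentiable Phi x by have [+ _] := Phi_C2; exact.
have dq s : I s -> differentiable q s by have [+ _] := Cq; exact.
have Cy : Ck 2 I y.
  apply: Ck_ext oI _ (Ck_comp oI oO qO Phi_C2 Cq) => s Is.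
  by rewrite yE.
have dyE s : I s -> 'D_1 y s = jac Phi (q s) *m 'D_1 q s.
  move=> Is; rewrite jacE; last exact/dPhi/qO.
  rewrite -(derive_comp _ (dq s Is) (dPhi _ (qO s Is))).
  by apply: near_eq_derive; apply: filterS (nearI s Is) => x /yE.
pose p (s : R^o) := G (y s) *m 'D_1 y s.
have dp : is_derive t (1 : R^o) p ('D_1 p t).
  apply: is_derive_diff.
  suff [+ _] : Ck 1 I p by exact.
  apply: Ck_mulmx => //; last by have [_ /(_ 1)] := Cy.
  exact: (Ck_comp oI openT _ G_C1 (CkS Cy)).
have CJ : Ck 1 I (jac Phi \o q).
  by apply: (Ck_comp oI oO qO _ (CkS Cq)); exact: Ck_jac.
have dJ : is_derive t (1 : R^o) (jac Phi \o q) ('D_1 (jac Phi \o q) t).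
  by apply: is_derive_diff; have [+ _] := CJ; exact.
set v := derive1 q t; have vE : v = 'D_1 q t by rewrite /v derive1E.
set z := 'D_1 y t.
have -> : derive1 (fun s => grad (chart_lagrangian (q s)) (derive1 q s)) t =
    ('D_1 (jac Phi \o q) t)^T *m p t + (jac Phi (q t))^T *m 'D_1 p t.
  rewrite derive1E; apply: etrans (@derive_val _ _ _ _ _ _ _
    (is_derive_mulmx (is_derive_trmx dJ) dp)).
  apply: near_eq_derive; apply: filterS (nearI t It) => s Is.
  by rewrite /= grad_velocity derive1E -dyE // -yE.
pose S x : R := 2^-1 * dot z (G x *m z).
have dS : differentiable (S : _ -> R^o) (y t).
  suff CS : Ck 1 setT (S : _ -> R^o) by exact: CS.1.
  apply: CkM; first exact: openT.
    exact: Ck_cst.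
  apply: Ck_entry; first exact: openT.
  apply: Ck_mulmx; [exact: openT|exact: Ck_cst|].
  by apply: Ck_mulmx => //; [exact: openT|exact: Ck_cst].
have -> : grad (fun x => chart_lagrangian x v) (q t) =
    ('D_1 (jac Phi \o q) t)^T *m p t
    + (jac Phi (q t))^T *m (grad S (y t) - grad U (y t)).
  apply/colP => j; rewrite mxE -[RHS]dot_delta dotDr -!dot_mulmx.
  move: (delta_mx j 0) => e.
  have Oq := qO t It; have [_ ddPhi] := Phi_C2.
  have zE : z = 'D_v Phi (q t).
    by rewrite /z (dyE t It) vE; exact: jacE (dPhi _ Oq).
  rewrite (jacE e (dPhi _ Oq)).
  set u := 'D_e Phi (q t).
  set a := 'D_e ('D_v Phi) (q t).
  have hW : is_derive (q t) e ('D_v Phi) a.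
    by apply: is_derive_diff; exact: (ddPhi v).1.
  have hG : is_derive (q t) e (G \o Phi) ('D_u G (Phi (q t))).
    have dG : differentiable G (Phi (q t)) by exact: G_C1.1.
    rewrite /u -(derive_comp e (dPhi _ Oq) dG).
    by apply: is_derive_diff; exact: differentiable_comp (dPhi _ Oq) dG.
  have hU : is_derive (q t) e ((U : _ -> R^o) \o Phi) ('D_u (U : _ ->
    R^o) (Phi (q t))).
    rewrite /u -(derive_comp e (dPhi _ Oq) (U_diff _)).
    by apply: is_derive_diff; exact: differentiable_comp (dPhi _ Oq) (U_diff _).
  have hL := is_derive_half (is_derive_dot hW (is_derive_mulmx hG hW)) hU.
  have -> : 'D_e (fun x => chart_lagrangian x v : R^o) (q t) =
      2^-1 * (dot a ((G \o Phi) (q t) *m 'D_v Phi (q t)) +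
      dot ('D_v Phi (q t)) ('D_u G (Phi (q t)) *m 'D_v Phi (q t)
        + (G \o Phi) (q t) *m a)) - 'D_u (U : _ -> R^o) (Phi (q t)).
    apply: etrans (@derive_val _ _ _ _ _ _ _ hL).
    apply: near_eq_derive; apply: filterS (nearO _ Oq) => x Ox.
    by rewrite /chart_lagrangian (jacE v (dPhi x Ox)).
  (* The left side is the derivative of ['D_e Phi] along [v], the right side that of ['D_v Phi]
     along [e]. *)
  have -> : 'D_1 (jac Phi \o q) t *m e = a.
    have h1 := is_derive_mulmxr e dJ.
    apply: etrans (esym (@derive_val _ _ _ _ _ _ _ h1)) _.
    have -> : 'D_1 (fun s => (jac Phi \o q) s *m e) t =
              'D_1 ('D_e Phi \o q) t.
      apply: near_eq_derive; apply: filterS (nearI t It) => s Is.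
      exact: jacE (dPhi _ (qO s Is)).
    have de : differentiable ('D_e Phi) (q t) by exact: (ddPhi e).1.
    apply: etrans (derive_comp (1 : R^o) (dq t It) de) _; rewrite -vE.
    exact: derive_sym oO Oq Phi_C2.
  have -> : dot u (grad S (y t) - grad U (y t)) =
      'D_u (S : _ -> R^o) (y t) - 'D_u (U : _ -> R^o) (y t).
    by rewrite dotC dotDl dotNl (dot_gradl u dS) (dot_gradl u (U_diff (y t))).
  have dG : differentiable G (y t) by exact: G_C1.1.
  have -> : 'D_u (S : _ -> R^o) (y t) = 2^-1 * dot z ('D_u G (y t) *m z).
    have hGz := is_derive_mulmx (is_derive_diff u dG) (is_derive_cst z (y t) u).
    have hS := is_derive_half (is_derive_dot (is_derive_cst z (y t) u) hGz)
      (is_derive_cst (0 : R^o) (y t) u).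
    have -> : (S : _ -> R^o) =
        fun x => 2^-1 * dot (cst z x) (G x *m cst z x) - cst 0 x : R^o.
      by apply/funext => x; rewrite /S subr0.
    apply: etrans (@derive_val _ _ _ _ _ _ _ hS) _.
    by rewrite dot0l add0r mulmx0 addr0 subr0.
  rewrite /p /= -zE -(yE t It) -/z dotDr.
  have -> : dot z (G (y t) *m a) = dot a (G (y t) *m z).
    by rewrite dotC dot_mulmx G_sym.
  lra.
rewrite opprD addrACA subrr add0r -mulmxBr; congr (_ *m _).
by rewrite opprB (addrC (grad U _)) addrA.
Qed.

End EulerLagrange.

(** * Linear maps, block columns and coordinate projections *)

Lemma differentiable_id (R : realType) (V : normedModType R) (x : V) :
  differentiable id x.
Proof. exact: ex_diff. Qed.

Lemma Ck_id (R : realType) (V : normedModType R) k (A : set V) : Ck k A id.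
Proof.
case: k => [|k]; first by move=> x _; exact: cvg_id.
split=> [x _|v]; first exact: differentiable_id.
rewrite (_ : 'D_v id = fun=> v); first exact: Ck_cst.
by apply/funext => x; rewrite derive_id.
Qed.

Section LinearMaps.
Context {R : realType} {n : nat} {W : normedModType R} (L : 'cV[R]_n -> W)
  (L_linear : linear L).

(** The section takes a plain function with a proof of linearity, so that [pos], [theta], [apart] or
    [Hrot] can be passed without a declared linear structure. *)
Let Ll : {linear 'cV[R]_n -> W} :=
  HB.pack L (GRing.isLinear.Build _ _ _ _ L L_linear).

Let cL : continuous L.
Proof.
by move=> x; apply: differentiable_continuous;
  exact: (linear_mx_differentiable Ll).
Qed.

Lemma linear_cV_continuous : continuous L.
Proof. exact: cL. Qed.

Lemma Ck_linear_cV (V : normedModType R) k (A : set V) f : open A ->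
  Ck k A f -> Ck k A (fun z => L (f z)).
Proof. by move=> oA; exact: (Ck_linear oA (L := Ll) cL). Qed.

Lemma derive_linear_cV (V : normedModType R) (f : V -> 'cV[R]_n) x v :
  differentiable f x -> 'D_v (fun z => L (f z)) x = L ('D_v f x).
Proof. exact: (derive_linear v (f := Ll) cL). Qed.

Lemma is_derive_linear_cV (V : normedModType R) (f : V -> 'cV[R]_n) x v :
  differentiable f x -> is_derive x v (fun z => L (f z)) (L ('D_v f x)).
Proof.
move=> df; rewrite -derive_linear_cV //; apply: is_derive_diff.
apply: (@differentiable_comp _ _ _ _ f L) => //.
exact: (linear_mx_differentiable Ll).
Qed.

End LinearMaps.

Section BlockSmoothness.
Context {R : realType} {V : normedModType R} {A : set V} (oA : open A).

Lemma Ck_mxcol k p (p_ : 'I_p -> nat) (f : forall i, V -> 'cV[R]_(p_ i)) :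
  (forall i, Ck k A (f i)) -> Ck k A (fun z => \mxcol_i f i z).
Proof.
move=> Cf; apply: Ck_mx => // a b.
apply: Ck_ext oA _ (Ck_entry oA (tagnat.sig2 a) b (Cf (tagnat.sig1 a))) => x _.
by rewrite mxE.
Qed.

Lemma Ck_trmx k m n (f : V -> 'M[R]_(m, n)) :
  Ck k A f -> Ck k A (fun z => (f z)^T).
Proof.
move=> Cf; apply: Ck_mx => // i j.
by apply: Ck_ext oA _ (Ck_entry oA j i Cf) => x _; rewrite mxE.
Qed.

Lemma Ck_col_mx k m n (f : V -> 'cV[R]_m) (g : V -> 'cV[R]_n) :
  Ck k A f -> Ck k A g -> Ck k A (fun z => col_mx (f z) (g z)).
Proof.
move=> Cf Cg; apply: Ck_mx => // a b; case: (split_ordP a) => i ->.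
  by apply: Ck_ext oA _ (Ck_entry oA i b Cf) => x _; rewrite col_mxEu.
by apply: Ck_ext oA _ (Ck_entry oA i b Cg) => x _; rewrite col_mxEd.
Qed.

End BlockSmoothness.

Section Projections.
Context {R : realType} {nb : nat}.

Lemma pos_linear (i : 'I_nb) : linear (fun y : 'cV[R]_(ydim nb) => pos y i).
Proof. by move=> a u v; apply/colP => j; rewrite !mxE. Qed.

Lemma theta_linear (i : 'I_nb) : linear (fun y : 'cV[R]_(ydim nb) => theta y i).
Proof. by move=> a u v; apply/colP => j; rewrite !mxE. Qed.

Lemma rpart_linear (i : 'I_nb) : linear (fun q : 'cV[R]_(qdim nb) => rpart q i).
Proof. by move=> a u v; apply/colP => j; rewrite !mxE. Qed.

Lemma apart_linear (i : 'I_nb) : linear (fun q : 'cV[R]_(qdim nb) => apart q i).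
Proof. by move=> a u v; apply/colP => j; rewrite !mxE. Qed.

Lemma Hbig_affine (y : 'cV[R]_(ydim nb)) : Hbig y = Hrot y + Hbig 0.
Proof. by rewrite /Hrot subrK. Qed.

Lemma Ck_Hbig (V : normedModType R) k (A : set V) f : open A ->
  Ck k A f -> Ck k A (fun z => Hbig (f z) : 'M[R]_(qdim nb, ydim nb)).
Proof.
move=> oA Cf.
have C := CkD oA (Ck_linear_cV (@Hrot_is_linear R nb) oA Cf) (Ck_cst k A (Hbig
  0)).
by apply: Ck_ext oA _ C => x _; rewrite [RHS]Hbig_affine.
Qed.

Lemma is_derive_Hbig (V : normedModType R) (f : V -> 'cV[R]_(ydim nb)) x v :
  differentiable f x ->
  is_derive x v (fun z => Hbig (f z)) (Hrot ('D_v f x)).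
Proof.
move=> df; rewrite -[Hrot _]addr0.
rewrite (_ : (fun z => _) = (fun z => Hrot (f z)) + cst (Hbig 0)); last first.
  by apply/funext => z; exact: Hbig_affine.
apply: is_deriveD; first exact: (is_derive_linear_cV (@Hrot_is_linear R nb)).
Qed.

End Projections.

(** * The inertial force in ambient coordinates *)

Section EquationsOfMotion.
Context {R : realType} {nb : nat} (m : 'I_nb -> R) (J : 'I_nb -> 'M[R]_3)
  (J_sym : forall i, (J i)^T = J i).

(** The kinetic energy as a quadratic form in the ambient velocity. By [Hmat_self] it degenerates
    along the normals of the spheres, so it cannot be inverted for the acceleration. *)
Definition mass_metric (y : 'cV[R]_(ydim nb)) : 'M[R]_(ydim nb) :=
  (Hbig y)^T *m (Ebig m J *m Hbig y).

Lemma mass_metric_sym y : (mass_metric y)^T = mass_metric y.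
Proof. by rewrite /mass_metric !trmx_mul trmxK Ebig_sym // mulmxA. Qed.

Lemma Ck_mass_metric k : Ck k setT mass_metric.
Proof.
have CH : Ck k setT (@Hbig R nb) := Ck_Hbig openT (@Ck_id _ _ k setT).
apply: Ck_mulmx; first exact: openT.
  apply: (Ck_trmx openT). exact: CH.
by apply: Ck_mulmx; [exact: openT|exact: Ck_cst|].
Qed.

Lemma LlocE U phi :
  Lloc m J U phi = chart_lagrangian mass_metric U (Phi phi).
Proof.
apply/funext => q; apply/funext => q1.
rewrite /Lloc /lagrangian kineticE /chart_lagrangian /mass_metric -!mulmxA.
by rewrite -dot_mulmx.
Qed.

(** With [z] the velocity, the derivative of [Hbig (y s)] contributes
    [(Hrot z)^T *m (E *m (Hbig (y t) *m z))] to the momentum derivative, the other contribution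
    vanishing by [Hrot z *m z = 0]. The gradient in [y] is the negative of the same vector by
    anticommutation, so it appears twice. *)
Lemma Hbig_inertial_force (y : R^o -> 'cV[R]_(ydim nb)) t :
  on_spheres (y t) -> differentiable y t -> differentiable ('D_1 y) t ->
  Hbig (y t) *m ('D_1 (fun s : R^o => mass_metric (y s) *m 'D_1 y s) t
    - grad (fun x => 2^-1 * dot ('D_1 y t) (mass_metric x *m 'D_1 y t)) (y t)) =
  Ebig m J *m (Hbig (y t) *m 'D_1 ('D_1 y) t)
    + 8 *: Ktilde J (y t) ('D_1 y t).
Proof.
move=> ys dy ddy; set z := 'D_1 y t; set y2 := 'D_1 ('D_1 y) t.
set E := Ebig m J.
have dH := is_derive_Hbig (1 : R^o) dy; rewrite -/z in dH.
have dz : is_derive t (1 : R^o) ('D_1 y) y2 by exact: is_derive_diff.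
have dHz := is_derive_mulmx dH dz.
have dEHz := is_derive_mulmxl E dHz.
have dp := is_derive_mulmx (is_derive_trmx dH) dEHz.
have -> : 'D_1 (fun s : R^o => mass_metric (y s) *m 'D_1 y s) t =
    (Hrot z)^T *m (E *m (Hbig (y t) *m z)) +
    (Hbig (y t))^T *m (E *m (Hbig (y t) *m y2)).
  have -> : (fun s : R^o => mass_metric (y s) *m 'D_1 y s) =
      fun s => (Hbig (y s))^T *m (E *m (Hbig (y s) *m 'D_1 y s)).
    by apply/funext => s; rewrite /mass_metric !mulmxA.
  apply: etrans (@derive_val _ _ _ _ _ _ _ dp) _.
  by rewrite -/z Hrot_self add0r.
have -> : grad (fun x => 2^-1 * dot z (mass_metric x *m z)) (y t) =
    - ((Hrot z)^T *m (E *m (Hbig (y t) *m z))).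
  apply/colP => j; rewrite mxE -[RHS]dot_delta; move: (delta_mx j 0) => e.
  have dHx := is_derive_Hbig e (differentiable_id (y t)).
  rewrite derive_id in dHx.
  have dHxz := is_derive_mulmxr z dHx.
  have dEHxz := is_derive_mulmxl E dHxz.
  have dS := is_derive_half (is_derive_dot dHxz dEHxz)
    (is_derive_cst (0 : R^o) (y t) e).
  have -> : (fun x => 2^-1 * dot z (mass_metric x *m z) : R^o) =
      fun x => 2^-1 * dot (Hbig x *m z) (E *m (Hbig x *m z))
        - cst 0 x : R^o.
    by apply/funext => x; rewrite subr0 /mass_metric -!mulmxA dot_mulmx.
  apply: etrans (@derive_val _ _ _ _ _ _ _ dS) _.
  rewrite subr0 /= Hrot_anticomm mulmxN dotNl !dotNr.
  rewrite [X in _ - X]dotC [X in _ - X]dot_mulmx Ebig_sym // dot_mulmx -/E.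
  lra.
rewrite opprK addrAC; set X := (Hrot z)^T *m _; set Y := (Hbig _)^T *m _.
have HX : Hbig (y t) *m X = 4 *: Ktilde J (y t) z by exact: Hbig_Hrot_Ktilde.
have HY : Hbig (y t) *m Y = E *m (Hbig (y t) *m y2).
  by rewrite /Y mulmxA Hbig_mul_tr // mul1mx.
move: X Y HX HY => X Y HX HY.
by rewrite !mulmxDr HX HY addrC -scalerDl -natrD.
Qed.

End EquationsOfMotion.

(** * Charts of the configuration space *)

Section Chart.
Context {R : realType} {nb : nat} (O : 'I_nb -> set 'cV[R]_3)
  (phi : 'I_nb -> 'cV[R]_3 -> 'cV[R]_4)
  (phi_param : forall i, local_param (O i) (phi i)).

Definition chart_domain : set 'cV[R]_(qdim nb) :=
  [set q | forall i, O i (apart q i)].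

Let oO i : open (O i). Proof. by case: (phi_param i). Qed.

Let Cphi i k : Ck k (O i) (phi i).
Proof. by case: (phi_param i) => _ + _; exact. Qed.

Let dphi i a : O i a -> differentiable (phi i) a.
Proof. by have [+ _] := @Cphi i 1; exact. Qed.

Lemma open_chart_domain : open chart_domain.
Proof.
rewrite openE => q qO; rewrite /interior.
have : \forall x \near q, forall i, O i (apart x i).
  apply: (@filter_forall _ 'I_nb (fun i x => O i (apart x i)) (nbhs q) _) => i.
  have c : {for q, continuous (fun x => apart x i)}.
    exact: (linear_cV_continuous (apart_linear i)).
  by apply: c; apply: open_nbhs_nbhs; split; [exact: oO|exact: qO].
exact.
Qed.

Lemma pos_Phi q i : pos (Phi phi q) i = rpart q i.
Proof. exact: pos_mxcol. Qed.

Lemma theta_Phi q i : theta (Phi phi q) i = phi i (apart q i).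
Proof. exact: theta_mxcol. Qed.

Lemma on_spheres_Phi q : chart_domain q -> on_spheres (Phi phi q).
Proof.
move=> qO i; rewrite theta_Phi.
have [_ _ [V [psi [_ _ img _]]]] := phi_param i.
have : (phi i @` O i) (phi i (apart q i)) by exists (apart q i).
by rewrite img => -[].
Qed.

Lemma Ck_Phi k : Ck k chart_domain (Phi phi).
Proof.
have oC := open_chart_domain.
apply: (Ck_mxcol oC (p_ := fun=> (3 + 4)%N)
  (f := fun i q => col_mx (rpart q i) (phi i (apart q i)))) => i.
apply: (Ck_col_mx oC).
  by apply: (Ck_linear_cV (rpart_linear i) oC); exact: Ck_id.
have Ca : Ck k chart_domain (fun q => apart q i).
  by apply: (Ck_linear_cV (apart_linear i) oC); exact: Ck_id.
have aO q : chart_domain q -> O i (apart q i) by exact.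
have C := Ck_comp oC (@oO i) (aO) (@Cphi i k) Ca.
by apply: Ck_ext oC _ C => q _.
Qed.

Lemma differentiable_Phi q : chart_domain q -> differentiable (Phi phi) q.
Proof. by have [+ _] := Ck_Phi 1; exact. Qed.

Lemma pos_derive_Phi q v i : chart_domain q ->
  pos ('D_v (Phi phi) q) i = rpart v i.
Proof.
move=> qO; rewrite -(derive_linear_cV (pos_linear i) v (differentiable_Phi qO)).
rewrite (_ : (fun _ => _) = fun x => rpart x i); last first.
  by apply/funext => x; exact: pos_Phi.
rewrite (derive_linear_cV (rpart_linear i) v (differentiable_id q)).
by rewrite derive_id.
Qed.

Lemma theta_derive_Phi q v i : chart_domain q ->
  theta ('D_v (Phi phi) q) i = jac (phi i) (apart q i) *m apart v i.
Proof.
move=> qO; rewrite -(derive_linear_cV (theta_linear i) v (differentiable_Phi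
  qO)).
rewrite (_ : (fun _ => _) = phi i \o (fun x => apart x i)); last first.
  by apply/funext => x; exact: theta_Phi.
rewrite (jacE _ (@dphi i _ (qO i))).
have da : is_derive q v (fun x => apart x i) (apart v i).
  have := is_derive_linear_cV (apart_linear i) v (differentiable_id q).
  by rewrite derive_id.
have dda : differentiable (fun x => apart x i) q.
  have [+ _] : Ck 1 chart_domain (fun x => apart x i).
    by apply: (Ck_linear_cV (apart_linear i) open_chart_domain); exact: Ck_id.
  exact.
rewrite -[in RHS](@derive_val _ _ _ _ _ _ _ da).
exact: (derive_comp v dda (@dphi i _ (qO i))).
Qed.

Lemma derive_Phi_tangent q v i : chart_domain q ->
  dot (theta (Phi phi q) i) (theta ('D_v (Phi phi) q) i) = 0.
Proof.
move=> qO; have dt := is_derive_linear_cV (theta_linear i) v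
  (differentiable_Phi qO).
have := @derive_val _ _ _ _ _ _ _ (is_derive_dot dt dt).
have -> : 'D_v (fun x => dot (theta (Phi phi x) i) (theta (Phi phi x) i) :
  R^o) q = 0.
  rewrite -[RHS](derive_cst (1 : R^o) q v); apply: near_eq_derive.
  apply: filterS (open_nbhs_nbhs (conj open_chart_domain qO)) => x xO.
  by rewrite on_spheres_Phi.
by rewrite [X in X + _]dotC; lra.
Qed.

(** The translations are copied unchanged, and on each sphere the chain rule for [psi \o phi i = id]
    recovers the direction from its image. *)
Lemma derive_Phi_inj q v : chart_domain q -> 'D_v (Phi phi) q = 0 -> v = 0.
Proof.
move=> qO v0; apply: q_ext => i.
  rewrite -(pos_derive_Phi v i qO) v0; apply/colP => j; by rewrite !mxE.
have [_ _ [V [psi [oV Cpsi img psiK]]]] := phi_param i.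
have Va : V (phi i (apart q i)).
  have : (phi i @` O i) (phi i (apart q i)) by exists (apart q i).
  by rewrite img => -[].
have dpsi : differentiable psi (phi i (apart q i)).
  by have [+ _] := Cpsi 1; exact.
have -> : apart v i = 'D_(apart v i) (psi \o phi i) (apart q i).
  rewrite -[LHS](derive_id (apart q i)); apply: near_eq_derive.
  by apply: filterS (open_nbhs_nbhs (conj (@oO i) (qO i))) => x xO;
    rewrite /= psiK.
rewrite (derive_comp _ (@dphi i _ (qO i)) dpsi) -(jacE _ (@dphi i _ (qO i))).
rewrite -theta_derive_Phi // v0.
have -> : theta 0 i = 0 :> 'cV[R]_4 by apply/colP => j; rewrite !mxE.
by rewrite derive0; apply/colP => j; rewrite !mxE.
Qed.

(** Take [C = Hbig (Phi phi q) *m jac (Phi phi) q]. The chart velocities are tangent to the spheres,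
    where [H^T H] acts as the identity; this gives the factorisation, and together with injectivity
    of the Jacobian the invertibility of [C]. *)
Lemma jac_Phi_factor q : chart_domain q ->
  exists2 C, C \in unitmx & jac (Phi phi) q = (Hbig (Phi phi q))^T *m C.
Proof.
move=> qO; exists (Hbig (Phi phi q) *m jac (Phi phi) q).
  apply: unitmx_injective => v; rewrite -mulmxA jacE => [E|]; last first.
    exact: differentiable_Phi.
  apply: (derive_Phi_inj qO).
  rewrite -[LHS](trHbig_mul_tangent (on_spheres_Phi qO)) ?E ?mulmx0 // => i.
  exact: derive_Phi_tangent.
apply: mulmx_ext => v; rewrite -!mulmxA jacE; last exact: differentiable_Phi.
rewrite trHbig_mul_tangent //; first exact: on_spheres_Phi.
by move=> i; exact: derive_Phi_tangent.
Qed.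

Lemma chart_annihilator q (X : 'cV[R]_(ydim nb)) : chart_domain q ->
  (jac (Phi phi) q)^T *m X = 0 <-> Hbig (Phi phi q) *m X = 0.
Proof.
move=> /jac_Phi_factor[C CU ->]; rewrite trmx_mul trmxK -mulmxA.
split=> [h|->]; last by rewrite mulmx0.
by rewrite -[LHS](@mulKmx _ _ _ C^T) ?unitmx_tr // h mulmx0.
Qed.

(** The two forces are compared through their virtual work on an arbitrary variation [v], which
    splits body by body. *)
Lemma FlocE F tau q (p : jet R nb) : chart_domain q -> p.1.2 = Phi phi q ->
  Floc F tau phi q p =
  (jac (Phi phi) q)^T *m ((Hbig p.1.2)^T *m Fext F tau p).
Proof.
move=> qO pq; apply: dot_inj => v; rewrite -dot_mulmx.
rewrite jacE; last exact: differentiable_Phi.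
rewrite dot_qcol dot_ycol; apply: eq_bigr => i _.
rewrite pos_derive_Phi // theta_derive_Phi // pos_trHbig theta_trHbig.
rewrite /Floc /Fext !rpart_mxcol !apart_mxcol dot_mulmx.
by rewrite -!scalemxAr mulmxA.
Qed.

(** Nothing is assumed about the regularity of [alpha]: it is [psi] composed with [theta], hence as
    regular as [y]. *)
Lemma chart_curve k (I : set R^o) (y : R^o -> 'cV[R]_(ydim nb))
    (alpha : 'I_nb -> R -> 'cV[R]_3) : open I -> Ck k I y ->
  (forall t i, I t -> O i (alpha i t) /\ theta (y t) i = phi i (alpha i t)) ->
  let q (t : R^o) : 'cV[R]_(qdim nb) :=
    \mxcol_(i < nb) (col_mx (pos (y t) i) (alpha i t) : 'cV[R]_(3 + 3)) in
  [/\ Ck k I q, forall t, I t -> chart_domain (q t) &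
      forall t, I t -> y t = Phi phi (q t)].
Proof.
move=> oI Cy yphi q; split; last 2 first.
- by move=> t It i; rewrite apart_mxcol; case: (yphi t i It).
- move=> t It; apply: y_ext => i; first by rewrite pos_Phi rpart_mxcol.
  by rewrite theta_Phi apart_mxcol; case: (yphi t i It).
apply: (Ck_mxcol oI (p_ := fun=> (3 + 3)%N)
  (f := fun i t => col_mx (pos (y t) i) (alpha i t))) => i.
apply: (Ck_col_mx oI).
  exact: (Ck_linear_cV (pos_linear i) oI).
have [_ _ [V [psi [oV Cpsi img psiK]]]] := phi_param i.
have yV t : I t -> V (theta (y t) i).
  move=> It; have [aO ->] := yphi t i It.
  have : (phi i @` O i) (phi i (alpha i t)) by exists (alpha i t).
  by rewrite img => -[].
have C : Ck k I (psi \o (fun t => theta (y t) i)).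
  apply: (Ck_comp oI oV yV (Cpsi k)).
  exact: (Ck_linear_cV (theta_linear i) oI).
apply: Ck_ext oI _ C => t It; have [aO E] := yphi t i It.
by rewrite /= E psiK.
Qed.

End Chart.

(** * Stereographic charts of the 3-sphere *)

Section Stereographic.
Context {R : realType} (th0 : 'cV[R]_4) (th0_unit : dot th0 th0 = 1).

(* Inverse stereographic projection from [- th0]; the rows of [Hmat th0] are an
   orthonormal basis of the tangent space at [th0]. *)
Definition stereo (a : 'cV[R]_3) : 'cV[R]_4 :=
  (1 + dot a a)^-1 *: (2 *: ((Hmat th0)^T *m a) + (1 - dot a a) *: th0).

Definition stereo_inv (x : 'cV[R]_4) : 'cV[R]_3 :=
  (1 + dot th0 x)^-1 *: (Hmat th0 *m x).

(** An open subset of R^4, as [local_param] requires for the inverse; it meets the sphere in every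
    point but [- th0]. *)
Definition stereo_codomain : set 'cV[R]_4 := [set x | 1 + dot th0 x != 0].

Lemma Ck_scalemx (V : normedModType R) k (A : set V) m n (f : V -> R^o)
    (g : V -> 'M[R]_(m, n)) : open A -> Ck k A f -> Ck k A g ->
  Ck k A (fun z => f z *: g z).
Proof.
move=> oA Cf Cg; apply: (Ck_mx oA) => i j.
have C := CkM oA Cf (Ck_entry oA i j Cg).
by apply: Ck_ext oA _ C => x _; rewrite mxE.
Qed.

Lemma Ck_dot (V : normedModType R) k (A : set V) n (f g : V -> 'cV[R]_n) :
  open A -> Ck k A f -> Ck k A g -> Ck k A (fun z => dot (f z) (g z) : R^o).
Proof.
move=> oA Cf Cg; apply: (Ck_entry oA); apply: (Ck_mulmx oA) => //.
exact: Ck_trmx.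
Qed.

Let den0 (a : 'cV[R]_3) : 1 + dot a a != 0.
Proof. by rewrite gt_eqF // ltr_pwDl // dot_ge0. Qed.

Let HHT : Hmat th0 *m (Hmat th0)^T = 1%:M.
Proof. by rewrite Hmat_mulT th0_unit. Qed.

Lemma open_stereo_codomain : open stereo_codomain.
Proof.
have C : Ck 0 setT (fun x => 1 + dot th0 x : R^o).
  apply: (CkD openT); first exact: Ck_cst.
  by apply: (Ck_dot openT); [exact: Ck_cst|exact: Ck_id].
rewrite openE => x x0; rewrite /interior.
have c : {for x, continuous (fun z => 1 + dot th0 z : R^o)} by exact: C.
apply: (c [set r : R | r != 0]).
by apply: open_nbhs_nbhs; split => //; exact: open_neq.
Qed.

Lemma dot_th0_stereo a : dot th0 (stereo a) = (1 - dot a a) / (1 + dot a a).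
Proof.
rewrite /stereo dotZr dotDr !dotZr th0_unit -dot_mulmx Hmat_self dot0l mulr0.
by rewrite add0r mulr1 mulrC.
Qed.

Lemma stereo_unit a : dot (stereo a) (stereo a) = 1.
Proof.
rewrite /stereo; set h := _^T *m a.
have ho : dot th0 h = 0 by rewrite -dot_mulmx Hmat_self dot0l.
have hh : dot h h = dot a a by rewrite /h dot_mulmx trmxK mulmxA HHT mul1mx.
rewrite !dotZl !dotZr dotDl !dotDr !dotZl !dotZr th0_unit (dotC h th0) ho hh.
by have da := den0 a; field.
Qed.

Lemma stereo_invK a : stereo_inv (stereo a) = a.
Proof.
rewrite /stereo_inv dot_th0_stereo /stereo -scalemxAr mulmxDr -!scalemxAr.
rewrite Hmat_self scaler0 addr0 mulmxA HHT mul1mx !scalerA.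
rewrite -[RHS]scale1r; congr (_ *: _); have da := den0 a.
rewrite (_ : 1 + _ / _ = 2 / (1 + dot a a)); last by field.
by field.
Qed.

Lemma stereoK x : sphere3 x -> stereo_codomain x -> stereo (stereo_inv x) = x.
Proof.
rewrite /sphere3 /= => x1; rewrite /stereo_codomain /= => cx.
set c := dot th0 x in cx.
(* [Hmat th0 *m x] has squared length [1 - c ^ 2], since [Hmat_trmul] projects away the component
   [c] along [th0]; one factor [1 + c] cancels. *)
have aa : dot (stereo_inv x) (stereo_inv x) = (1 - c) / (1 + c).
  rewrite /stereo_inv -/c dotZl dotZr dot_mulmx mulmxA Hmat_trmul th0_unit.
  rewrite mulmxBl mul1mx dotDr dotNr x1 -mulmxA.
  rewrite (_ : th0^T *m x = c%:M); last by apply/matrixP => i j;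
    rewrite !ord1 [RHS]mxE.
  by rewrite mul_mx_scalar dotZr [dot x _]dotC -/c; field.
have c2 : 1 + (1 - c) / (1 + c) != 0.
  rewrite (_ : _ + _ = 2 / (1 + c)); last by field.
  by rewrite mulf_neq0 // invr_neq0.
rewrite /stereo aa /stereo_inv -/c -scalemxAr mulmxA Hmat_trmul th0_unit.
rewrite mulmxBl mul1mx -mulmxA.
rewrite (_ : th0^T *m x = c%:M); last by apply/matrixP => i j;
  rewrite !ord1 [RHS]mxE.
rewrite (_ : 1 + _ / _ = 2 / (1 + c)); last by field.
rewrite mul_mx_scalar; apply/colP => i; rewrite !mxE.
by field.
Qed.

Lemma stereo_param : local_param setT stereo.
Proof.
split; first exact: openT.
  move=> k.
  have Cd : Ck k setT (fun a : 'cV[R]_3 => dot a a : R^o).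
    by apply: (Ck_dot openT); exact: Ck_id.
  apply: (Ck_scalemx openT).
    apply: (CkV openT); first by move=> a _; exact: den0.
    by apply: (CkD openT) => //; exact: Ck_cst.
  apply: (CkD openT).
    apply: (Ck_scalemx openT); first exact: Ck_cst.
    by apply: (Ck_mulmx openT); [exact: Ck_cst|exact: Ck_id].
  apply: (Ck_scalemx openT); last exact: Ck_cst.
  apply: (CkD openT (g := fun a => - dot a a)); first exact: Ck_cst.
  have C := CkM openT (Ck_cst k setT (-1 : R^o)) Cd.
  by apply: Ck_ext openT _ C => a _; rewrite mulN1r.
exists stereo_codomain, stereo_inv; split.
- exact: open_stereo_codomain.
- move=> k; have oC := open_stereo_codomain.
  apply: (Ck_scalemx oC).
    apply: (CkV oC) => //.
    apply: (CkD oC); first exact: Ck_cst.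
    by apply: (Ck_dot oC); [exact: Ck_cst|exact: Ck_id].
  by apply: (Ck_mulmx oC); [exact: Ck_cst|exact: Ck_id].
- apply/seteqP; split=> [_ [a _ <-]|x [Sx Vx]].
    split; first exact: stereo_unit.
    rewrite /stereo_codomain /= dot_th0_stereo.
    rewrite (_ : _ + _ = 2 / (1 + dot a a)); last by have da := den0 a; field.
    by rewrite mulf_neq0 // invr_neq0.
  by exists (stereo_inv x) => //; exact: stereoK.
- by move=> a _; exact: stereo_invK.
Qed.

Lemma stereo_codomain_center : stereo_codomain th0.
Proof. by rewrite /stereo_codomain /= th0_unit gt_eqF. Qed.

End Stereographic.

(** * Equivalence with the reduced equations *)

(** [Jt] may be replaced by [H] because their kernels agree; [H *m H^T = 1] then releases the force
    [f]. *)
Lemma force_balance_projection (F : realFieldType) k n p (Jt : 'M[F]_(k, n))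
    (H : 'M[F]_(p, n)) (X gU c : 'cV[F]_n) (a K f : 'cV[F]_p) :
  (forall v : 'cV[F]_n, Jt *m v = 0 <-> H *m v = 0) -> H *m H^T = 1%:M ->
  H *m X = a + K ->
  Jt *m (X + gU) = Jt *m (H^T *m f) - Jt *m c <->
  a + H *m c = f - K - H *m gU.
Proof.
move=> ann HHT HX.
have -> : Jt *m (X + gU) = Jt *m (H^T *m f) - Jt *m c <->
    Jt *m (X + gU - (H^T *m f - c)) = 0.
  rewrite mulmxBr mulmxBr; split=> [->|/eqP]; first by rewrite subrr.
  by rewrite subr_eq0 => /eqP.
rewrite ann mulmxBr mulmxDr mulmxBr mulmxA HHT mul1mx HX.
move: (H *m gU) (H *m c) => u v.
by split=> /colP E; apply/colP => i; have := E i; rewrite !mxE; lra.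
Qed.

Section Dynamics.
Context {R : realType} {nb l : nat} (m : 'I_nb -> R) (J : 'I_nb -> 'M[R]_3)
  (F tau : 'I_nb -> jet R nb -> 'cV[R]_3) (U : 'cV[R]_(ydim nb) -> R)
  (g : 'cV[R]_(ydim nb) -> 'cV[R]_l).
Context (J_sym : forall i, (J i)^T = J i)
  (U_diff : forall y, differentiable (U : _ -> R^o) y)
  (g_diff : forall y, differentiable g y).

Lemma lagrange_equation_reduction (O : 'I_nb -> set 'cV[R]_3)
    (phi : 'I_nb -> 'cV[R]_3 -> 'cV[R]_4) (alpha : 'I_nb -> R -> 'cV[R]_3)
    (I : set R^o) (y : R^o -> 'cV[R]_(ydim nb)) t lam :
  (forall i, local_param (O i) (phi i)) -> open I -> Ck 2 I y ->
  (forall t i, I t -> O i (alpha i t) /\ theta (y t) i = phi i (alpha i t)) ->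
  I t ->
  let q : R -> 'cV[R]_(qdim nb) := fun t =>
    \mxcol_(i < nb) (col_mx (pos (y t) i) (alpha i t) : 'cV[R]_(3 + 3)) in
  derive1 (fun s => grad (Lloc m J U phi (q s)) (derive1 q s)) t
    - grad (fun x => Lloc m J U phi x (derive1 q t)) (q t)
    = Floc F tau phi (q t) (prolong y t) - (jac (g \o Phi phi) (q t))^T *m lam
  <->
  Ebig m J *m (Hbig (y t) *m 'D_1 ('D_1 y) t)
    + Hbig (y t) *m (jac g (y t))^T *m lam
  = Fext F tau (prolong y t) - 8 *: Ktilde J (y t) ('D_1 y t)
    - Hbig (y t) *m grad U (y t).
Proof.
move=> lp oI Cy yphi It q.
have [Cq qO yE] := chart_curve lp oI Cy yphi.
have {}Cq : Ck 2 I (q : R^o -> _) := Cq.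
have {}qO t' : I t' -> chart_domain O (q t') := qO t'.
have {}yE t' : I t' -> y t' = Phi phi (q t') := yE t'.
clearbody q.
have qtO : chart_domain O (q t) := qO t It.
have yt : y t = Phi phi (q t) := yE t It.
rewrite !LlocE.
rewrite (euler_lagrange_chart (open_chart_domain lp) (Ck_Phi lp 2)
  (Ck_mass_metric m J 1) (mass_metric_sym m J_sym) U_diff oI It qO yE Cq).
rewrite (FlocE lp F tau (p := prolong y t) qtO yt).
move: (q t) qtO yt => x xO yt.
have -> : jac (g \o Phi phi) x = jac g (y t) *m jac (Phi phi) x.
  have dP := differentiable_Phi lp xO.
  apply: mulmx_ext => u; rewrite -mulmxA (jacE _ dP) (jacE _ (g_diff _)).
  rewrite (jacE _ (differentiable_comp dP (g_diff _))) yt.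
  exact: derive_comp dP (g_diff _).
set JP := jac (Phi phi) x.
have Ht : on_spheres (y t) by rewrite yt; exact: on_spheres_Phi lp _ xO.
have dy : differentiable y t by have [+ _] := Cy; exact.
have ddy : differentiable ('D_1 y) t by have [_ /(_ 1)[+ _]] := Cy; exact.
have HPS := Hbig_inertial_force m J_sym Ht dy ddy.
have E : (jac g (y t) *m JP)^T *m lam = JP^T *m ((jac g (y t))^T *m lam).
  by rewrite trmx_mul mulmxA.
rewrite E -(mulmxA (Hbig (y t))).
set X := (X in _ *m (X + _) = _); rewrite -/X in HPS.
set a := Ebig m J *m _ in HPS *; set K := 8 *: _ in HPS *.
move: X a K HPS {E}; rewrite {}/JP => X a K HPS.
have ann (v : 'cV[R]_(ydim nb)) :
    (jac (Phi phi) x)^T *m v = 0 <-> Hbig (y t) *m v = 0.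
  rewrite yt; exact: chart_annihilator lp _ _ xO.
have B := force_balance_projection (grad U (y t)) ((jac g (y t))^T *m lam)
  (Fext F tau (prolong y t)) ann (Hbig_mul_tr Ht) HPS.
exact: B.
Qed.

End Dynamics.

(** * Constraints differentiated along a curve *)

Lemma derive_jac_comp (R : realType) n p (f : 'cV[R]_n -> 'cV[R]_p)
    (y : R^o -> 'cV[R]_n) t z : Ck 2 setT f -> differentiable y t ->
  'D_1 (jac f \o y) t *m z = 'D_('D_1 y t) ('D_z f) (y t).
Proof.
move=> Cf dy; have [df ddf] := Cf.
have dj : differentiable (jac f) (y t).
  by exact: (Ck_jac openT Cf).1.
have dJ := is_derive_diff (1 : R^o) (differentiable_comp dy dj).
have h := is_derive_mulmxr z dJ.
apply: etrans (esym (@derive_val _ _ _ _ _ _ _ h)) _.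
have -> : (fun s => (jac f \o y) s *m z) = 'D_z f \o y.
  by apply/funext => s; exact: jacE (df _ I).
by apply: derive_comp dy _; exact: (ddf z).1.
Qed.

Section ConstrainedCurves.
Context {R : realType} {nb l : nat} (g : 'cV[R]_(ydim nb) -> 'cV[R]_l)
  (g_C2 : Ck 2 setT g).

(** Stated for any constraint map [f]: it serves for [g] along motions and for the joint constraint
    map in the tangency argument. *)
Lemma constraint_derivatives p (f : 'cV[R]_p -> 'cV[R]_l) (I : set R^o)
    (y : R^o -> 'cV[R]_p) : Ck 2 setT f -> open I -> Ck 2 I y ->
  (forall t, I t -> f (y t) = 0) -> forall t, I t ->
  jac f (y t) *m 'D_1 y t = 0 /\
  jac f (y t) *m 'D_1 ('D_1 y) t + d2 f (y t) ('D_1 y t) ('D_1 y t) = 0.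
Proof.
move=> Cf oI Cy fy0.
have df x : differentiable f x by have [+ _] := Cf; exact.
have dy t : I t -> differentiable y t by have [+ _] := Cy; exact.
have ddy t : I t -> differentiable ('D_1 y) t.
  by have [_ /(_ 1)[+ _]] := Cy; exact.
have near0 t : I t -> \forall s \near t, I s.
  by move=> It; exact: open_nbhs_nbhs.
have d1 t : I t -> jac f (y t) *m 'D_1 y t = 0.
  move=> It; rewrite jacE // -(derive_comp _ (dy t It) (df _)).
  rewrite -[RHS](derive_cst (0 : 'cV[R]_l) t (1 : R^o)); apply: near_eq_derive.
  by apply: filterS (near0 t It) => s /fy0.
move=> t It; split; first exact: d1.
have dj : differentiable (jac f) (y t).
  by have [+ _] := Ck_jac openT Cf; exact.
have dJ := is_derive_diff (1 : R^o) (differentiable_comp (dy t It) dj).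
have h := is_derive_mulmx dJ (is_derive_diff (1 : R^o) (ddy t It)).
have := @derive_val _ _ _ _ _ _ _ h; rewrite derive_jac_comp //; last exact: dy.
rewrite /d2 addrC => <-.
rewrite -[RHS](derive_cst (0 : 'cV[R]_l) t (1 : R^o)); apply: near_eq_derive.
by apply: filterS (near0 t It) => s /d1.
Qed.

Lemma sphere_derivatives (I : set R^o) (y : R^o -> 'cV[R]_(ydim nb)) :
  open I -> Ck 2 I y -> (forall t, I t -> on_spheres (y t)) ->
  forall t i, I t -> dot (theta (y t) i) (theta ('D_1 y t) i) = 0 /\
    dot (theta (y t) i) (theta ('D_1 ('D_1 y) t) i) =
      - dot (theta ('D_1 y t) i) (theta ('D_1 y t) i).
Proof.
move=> oI Cy ys t i It.
have dy s : I s -> differentiable y s by have [+ _] := Cy; exact.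
have ddy s : I s -> differentiable ('D_1 y) s.
  by have [_ /(_ 1)[+ _]] := Cy; exact.
have near0 s : I s -> \forall x \near s, I x.
  by move=> Is; exact: open_nbhs_nbhs.
have dth s : I s -> is_derive s (1 : R^o) (fun x => theta (y x) i)
    (theta ('D_1 y s) i).
  by move=> Is; apply: (is_derive_linear_cV (theta_linear i)); exact: dy.
have ddth s : I s -> is_derive s (1 : R^o) (fun x => theta ('D_1 y x) i)
    (theta ('D_1 ('D_1 y) s) i).
  by move=> Is; apply: (is_derive_linear_cV (theta_linear i)); exact: ddy.
have o1 s : I s -> dot (theta (y s) i) (theta ('D_1 y s) i) = 0.
  move=> Is; have := @derive_val _ _ _ _ _ _ _ (is_derive_dot (dth s Is) (dth s
    Is)).
  rewrite (near_eq_derive (g := cst (1 : R^o))) ?derive_cst.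
    by rewrite [X in X + _]dotC; lra.
  by apply: filterS (near0 s Is) => x Ix; exact: ys.
split; first exact: o1.
have E : 'D_1 (fun x => dot (theta (y x) i) (theta ('D_1 y x) i) : R^o) t = 0.
  rewrite -[RHS](derive_cst (0 : R^o) t (1 : R^o)); apply: near_eq_derive.
  by apply: filterS (near0 t It) => x Ix; exact: o1.
rewrite (@derive_val _ _ _ _ _ _ _ (is_derive_dot (dth t It) (ddth t It))) in E.
by move/eqP: E; rewrite addrC addr_eq0 => /eqP.
Qed.

(** The kinematic half: no force enters, and the second line of the linear system holds for
    [d = H y_2] on any curve that respects the constraints. *)
Lemma constrained_curve (I : set R^o) (y : R^o -> 'cV[R]_(ydim nb)) :
  open I -> Ck 2 I y -> (forall t, I t -> on_spheres (y t)) ->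
  (forall t, I t -> g (y t) = 0) -> forall t, I t ->
  let y2 := 'D_1 ('D_1 y) t in
  [/\ Mset g (prolong y t), accel (prolong y t) (Hbig (y t) *m y2) = y2 &
    jac g (y t) *m (Hbig (y t))^T *m (Hbig (y t) *m y2) =
    jac g (y t) *m Ibig ('D_1 y t) *m y t
      - d2 g (y t) ('D_1 y t) ('D_1 y t)].
Proof.
move=> oI Cy ys gy t It y2.
have [g1 g2] := constraint_derivatives g_C2 oI Cy gy It.
have s1 i := (sphere_derivatives oI Cy ys i It).1.
have s2 i := (sphere_derivatives oI Cy ys i It).2.
have acc : (Hbig (y t))^T *m (Hbig (y t) *m y2) - Ibig ('D_1 y t) *m y t = y2.
  by apply: trHbig_mul_acceleration => //; exact: ys.
split.
- split; first by move=> i; split; [exact: ys|rewrite /= derive1E; exact: s1].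
  by split; [exact: gy|rewrite /= derive1E].
- by rewrite /accel /= derive1E.
- rewrite -mulmxA -[in LHS](subrK (Ibig ('D_1 y t) *m y t) (_ *m _)) acc.
  rewrite mulmxDr mulmxA addrC.
  have -> : jac g (y t) *m y2 = - d2 g (y t) ('D_1 y t) ('D_1 y t).
    by apply/eqP; rewrite -addr_eq0 g2.
  by [].
Qed.

End ConstrainedCurves.

(** * Tangency to the state space *)

Lemma is_derive_scale (R : realType) (W : normedModType R) (w : W) (s : R^o) :
  is_derive s (1 : R^o) (fun t : R^o => t *: w) w.
Proof.
have := is_derive_line (u := w) (z := 0) (differentiable_id (s *: w + 0)).
by rewrite derive_id; under eq_fun do rewrite addr0.
Qed.

Section CurveThroughJet.
Context {R : realType} {n k : nat} (h : 'cV[R]_n -> 'cV[R]_k)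
  (P : 'M[R]_(n, k)) (y0 a b : 'cV[R]_n).
Context (h_smooth : smooth_on setT h) (hy0 : h y0 = 0)
  (jacP : jac h y0 *m P = 1%:M) (ha : jac h y0 *m a = 0)
  (hb : jac h y0 *m b + d2 h y0 a a = 0).

(** The quadratic term is written as a matrix product so that [is_derive_mulmx] and [Ck_mulmx]
    apply. *)
Let c (s : R^o) : 'cV[R]_n :=
  y0 + (s *: a + (s *: 1%:M) *m (s *: (2^-1 *: b))).

Let dc s : is_derive s (1 : R^o) c (a + s *: b).
Proof.
have h1 := is_derive_mulmx (is_derive_scale 1%:M s) (is_derive_scale (2^-1 *:
  b) s).
have h2 := is_deriveD (is_derive_cst y0 s (1 : R^o))
  (is_deriveD (is_derive_scale a s) h1).
apply: (is_derive_eq h2); rewrite add0r mul1mx -scalemxAl mul1mx -mulr2n.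
by rewrite -[_ *+ 2]scaler_nat !scalerA mulrAC mulfV ?mul1r // pnatr_eq0.
Qed.

Let c_smooth : smooth_on setT c.
Proof.
move=> j; apply: (CkD openT); first exact: Ck_cst.
have Cs m p (w : 'M[R]_(m, p)) : Ck j setT (fun s : R^o => s *: w).
  by apply: (Ck_scalemx openT (f := id)); [exact: Ck_id|exact: Ck_cst].
by apply: (CkD openT) => //; exact: (Ck_mulmx openT).
Qed.

Let c0 : c 0 = y0.
Proof. by rewrite /c !scale0r mul0mx !addr0. Qed.

(** The correction [P *m w s] vanishes to second order at 0: by [ha] and [hb] the constraints
    differentiated once and twice along the curve leave only [dh P] applied to [w'] and to [w''],
    and [dh P = 1]. *)
Lemma curve_through_jet : exists (e : R) (y : R^o -> 'cV[R]_n), [/\ 0 < e,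
  smooth_on (ball (0 : R^o) e) y, forall s, ball (0 : R^o) e s -> h (y s) = 0,
  y 0 = y0 & 'D_1 y 0 = a /\ 'D_1 ('D_1 y) 0 = b].
Proof.
have hc0 : h (c 0) = 0 by rewrite c0.
have jcP : jac h (c 0) *m P = 1%:M by rewrite c0.
have [e [w [e0 w_smooth w0 hw]]] := implicit_curve h_smooth c_smooth hc0 jcP.
pose y s := c s + P *m w s.
have oB : open (ball (0 : R^o) e) by exact: ball_open.
have B0 : ball (0 : R^o) e 0 by exact: ballxx.
have near0 s : ball (0 : R^o) e s -> \forall t \near s, ball (0 : R^o) e t.
  by move=> Bs; exact: open_nbhs_nbhs.
have y_smooth : smooth_on (ball (0 : R^o) e) y.
  move=> j; apply: (CkD oB); first exact: Ck_sub (@subsetT _ _) (c_smooth j).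
  by apply: (Ck_mulmx oB); [exact: Ck_cst|exact: w_smooth].
have y00 : y 0 = y0 by rewrite /y c0 w0 mulmx0 addr0.
have dw s : ball (0 : R^o) e s -> differentiable w s.
  by have [+ _] := w_smooth 1; exact.
have ddw s : ball (0 : R^o) e s -> differentiable ('D_1 w) s.
  by have [_ /(_ 1)[+ _]] := w_smooth 2; exact.
have dy s : ball (0 : R^o) e s -> 'D_1 y s = (a + s *: b) + P *m 'D_1 w s.
  move=> Bs; have h1 := is_derive_mulmxl P (is_derive_diff (1 : R^o) (dw s Bs)).
  exact: (@derive_val _ _ _ _ _ _ _ (is_deriveD (dc s) h1)).
have ddy : 'D_1 ('D_1 y) 0 = b + P *m 'D_1 ('D_1 w) 0.
  have h1 := is_derive_mulmxl P (is_derive_diff (1 : R^o) (ddw 0 B0)).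
  have h2 := is_deriveD (is_deriveD (is_derive_cst a (0 : R^o) (1 : R^o))
    (is_derive_scale b (0 : R^o))) h1.
  rewrite add0r in h2; apply: etrans (@derive_val _ _ _ _ _ _ _ h2).
  by apply: near_eq_derive; apply: filterS (near0 0 B0) => s /dy.
have [hd1 hd2] := constraint_derivatives (h_smooth 2) oB (y_smooth 2) hw B0.
have w1 : 'D_1 w 0 = 0.
  move: hd1; rewrite y00 (dy 0 B0) scale0r addr0 mulmxDr ha add0r mulmxA jacP.
  by rewrite mul1mx.
have dy0 : 'D_1 y 0 = a by rewrite (dy 0 B0) scale0r addr0 w1 mulmx0 addr0.
have w2 : 'D_1 ('D_1 w) 0 = 0.
  move: hd2; rewrite y00 ddy dy0 mulmxDr addrAC hb add0r mulmxA jacP.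
  by rewrite mul1mx.
exists e, y; split=> //; split=> //.
by rewrite ddy w2 mulmx0 addr0.
Qed.

End CurveThroughJet.

Lemma col_mx0P (R : nmodType) p q n (a : 'M[R]_(p, n)) (b : 'M[R]_(q, n)) :
  col_mx a b = 0 <-> a = 0 /\ b = 0.
Proof.
split=> [/eqP|[-> ->]]; last exact: col_mx0.
by rewrite col_mx_eq0 => /andP[/eqP-> /eqP->].
Qed.

Lemma is_derive_col_mx (R : realType) (V : normedModType R) p q
    (f : V -> 'cV[R]_p) (g : V ->
      'cV[R]_q) (df : 'cV[R]_p) (dg : 'cV[R]_q) x v :
  is_derive x v f df -> is_derive x v g dg ->
  is_derive x v (fun z => col_mx (f z) (g z)) (col_mx df dg).
Proof.
move=> hf hg; apply: is_derive_mx => i j; case: (split_ordP i) => i' ->.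
  rewrite (_ : (fun z => _) = fun z => f z i' j : R^o); last first.
    by apply/funext => z; rewrite col_mxEu.
  by rewrite col_mxEu; exact: is_derive_entry.
rewrite (_ : (fun z => _) = fun z => g z i' j : R^o); last first.
  by apply/funext => z; rewrite col_mxEd.
by rewrite col_mxEd; exact: is_derive_entry.
Qed.

Lemma d2_scale (R : realType) n p (f : 'cV[R]_n -> 'cV[R]_p) x u (k : R) :
  Ck 2 setT f -> d2 f x (k *: u) (k *: u) = (k * k) *: d2 f x u u.
Proof.
move=> [df ddf]; rewrite /d2.
have -> : (fun z => 'D_(k *: u) f z) = k \*: 'D_u f.
  by apply/funext => z; exact: deriveZv (df z I).
have ddu : differentiable ('D_u f) x by exact: (ddf u).1.
rewrite deriveZv; last exact: differentiableZ.
by rewrite deriveZ ?scalerA //; exact: diff_derivable.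
Qed.

Section StateManifold.
Context {R : realType} {nb l : nat} (g : 'cV[R]_(ydim nb) -> 'cV[R]_l)
  (g_smooth : smooth_on setT g).

Let dg x : differentiable g x.
Proof. by have [+ _] := g_smooth 1; exact. Qed.

Definition all_constraints (y : 'cV[R]_(ydim nb)) : 'cV[R]_(l + nb) :=
  col_mx (g y) (\col_i (dot (theta y i) (theta y i) - 1)).

(** The derivative along [v] of the sphere constraints. As it is linear in [y] too, it also gives
    their second derivative. *)
Definition sphere_part (y v : 'cV[R]_(ydim nb)) : 'cV[R]_nb :=
  \col_i (2 * dot (theta y i) (theta v i)).

Lemma all_constraints_smooth : smooth_on setT all_constraints.
Proof.
move=> k; apply: (Ck_col_mx openT); first exact: g_smooth.
apply: (Ck_mx openT) => i j.
have Ct : Ck k setT (fun y : 'cV[R]_(ydim nb) => theta y i).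
  by apply: (Ck_linear_cV (theta_linear i) openT); exact: Ck_id.
have C := CkD openT (Ck_dot openT Ct Ct) (Ck_cst k setT (-1 : R^o)).
by apply: Ck_ext openT _ C => y _; rewrite mxE.
Qed.

Let dh x : differentiable all_constraints x.
Proof. by have [+ _] := all_constraints_smooth 1; exact. Qed.

Let dtheta y v i : is_derive y v (fun z : 'cV[R]_(ydim nb) =>
  theta z i) (theta v i).
Proof.
have := is_derive_linear_cV (theta_linear i) v (differentiable_id y).
by rewrite derive_id.
Qed.

Lemma all_constraints_eq0 y :
  all_constraints y = 0 <-> on_spheres y /\ g y = 0.
Proof.
rewrite /all_constraints col_mx0P.
split=> [[gy /colP s]|[s gy]]; split=> //.
  by move=> i; have := s i; rewrite !mxE => /eqP; rewrite subr_eq0 => /eqP.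
by apply/colP => i; rewrite !mxE s subrr.
Qed.

Lemma derive_all_constraints y v : 'D_v all_constraints y =
  col_mx (jac g y *m v) (sphere_part y v).
Proof.
rewrite (jacE _ (dg y)).
apply: (@derive_val _ _ _ _ _ _ _ (is_derive_col_mx (is_derive_diff v (dg y))
  _)).
apply: is_derive_mx => i j; rewrite mxE.
have h := is_deriveB (is_derive_dot (dtheta y v i) (dtheta y v i))
  (is_derive_cst (1 : R^o) y v).
rewrite (_ : (fun z => _) = (fun z =>
  dot (theta z i) (theta z i) : R^o) - cst 1).
  by apply: (is_derive_eq h); rewrite subr0 [X in X + _]dotC; lra.
by apply/funext => z; rewrite mxE.
Qed.

Lemma Mset_all_constraints (p : jet R nb) : Mset g p <->
  all_constraints p.1.2 = 0 /\ jac all_constraints p.1.2 *m p.2 = 0.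
Proof.
rewrite jacE // derive_all_constraints all_constraints_eq0 col_mx0P.
split=> [[ps [gp gp1]]|[[ps gp] [gp1 /colP s]]].
  split; first by split=> // i; case: (ps i).
  by split=> //; apply/colP => i; rewrite !mxE (ps i).2 mulr0.
split; last by split.
move=> i; split; first exact: ps.
by have := s i; rewrite !mxE => /eqP; rewrite mulf_eq0 pnatr_eq0 => /eqP.
Qed.

Lemma d2_all_constraints y u v : d2 all_constraints y u v =
  col_mx (d2 g y u v) (sphere_part u v).
Proof.
rewrite {1}/d2.
have -> : (fun z => 'D_v all_constraints z) =
    fun z => col_mx ('D_v g z) (sphere_part z v).
  by apply/funext => z; rewrite derive_all_constraints jacE.
have ddg : differentiable ('D_v g) y by have [_ /(_ v)[+ _]] := g_smooth 2;
  exact.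
apply: (@derive_val _ _ _ _ _ _ _ (is_derive_col_mx (is_derive_diff u ddg) _)).
apply: is_derive_mx => i j; rewrite mxE.
have h := is_deriveZ (2 : R)
  (is_derive_dot (dtheta y u i) (is_derive_cst (theta v i) y u)).
rewrite (_ : (fun z => _) =
  2 \*: (fun z => dot (theta z i) (cst (theta v i) z) : R^o)); last first.
  by apply/funext => z; rewrite mxE.
by apply: (is_derive_eq h); rewrite dot0r addr0.
Qed.

(** A row vector that annihilates the joint Jacobian is tested in two families of directions, in
    which the Jacobian is block triangular: the range of [H^T] kills its [g] part, then the normals
    of the spheres kill the rest. *)
Lemma all_constraints_right_inverse (y : 'cV[R]_(ydim nb)) : on_spheres y ->
  \rank (jac g y *m (Hbig y)^T) = l ->
  exists P, jac all_constraints y *m P = 1%:M.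
Proof.
move=> ys rk; exists (pinvmx (jac all_constraints y)); apply: mulmxVp.
rewrite -kermx_eq0; apply/eqP/row_matrixP => r; rewrite row0.
set u := row r _; have u0 v : u *m 'D_v all_constraints y = 0.
  by rewrite -jacE // mulmxA -row_mul mulmx_ker row0 mul0mx.
have : u = row_mx (lsubmx u) (rsubmx u) by rewrite hsubmxK.
move: (lsubmx u) (rsubmx u) => b a uE; rewrite {}uE in u0 *.
have {}u0 v : b *m (jac g y *m v) + a *m sphere_part y v = 0.
  by rewrite -mul_row_col -derive_all_constraints u0.
(* On the range of [H^T] the sphere constraints have zero derivative. *)
have b0 : b = 0.
  apply: (row_free_inj (A := jac g y *m (Hbig y)^T));
    first by rewrite /row_free rk.
  rewrite mul0mx; apply: mulmx_ext => d; rewrite mul0mx -!mulmxA.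
  rewrite -[RHS](u0 ((Hbig y)^T *m d)) [X in _ = _ + a *m X](_ :
    _ = 0) ?mulmx0 ?addr0 //.
  apply/colP => i; rewrite !mxE theta_trHbig -dot_mulmx Hmat_self dot0l mulr0.
  by [].
have a0 : a = 0.
  (* The normal of the [i]th sphere, a direction that moves only the [i]th sphere constraint, at
     rate 2. *)
  apply/rowP => i; pose v : 'cV[R]_(ydim nb) := \mxcol_(j < nb)
    (col_mx 0 (if j == i then theta y i else 0) : 'cV[R]_(3 + 4)).
  have := u0 v; rewrite b0 mul0mx add0r => /matrixP/(_ 0 0).
  rewrite !mxE (bigD1 i) //= big1 ?addr0 => [|j ji].
    rewrite mxE theta_mxcol eqxx ys mulr1 => /eqP.
    by rewrite mulf_eq0 pnatr_eq0 orbF => /eqP.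
  by rewrite mxE theta_mxcol (negbTE ji) dot0r !mulr0.
by rewrite a0 b0 row_mx0.
Qed.

(** A multiple [k] means running through the curve at speed [k]: the jet becomes
    [(y, k y1, k^2 y2)], and the velocity component is divided by [k] to start again at [y1]. For
    [k = 0] the constant curve is taken. *)
Lemma tangent_Mset (p : jet R nb) y2 k : Mset g p ->
  \rank (jac g p.1.2 *m (Hbig p.1.2)^T) = l ->
  jac g p.1.2 *m y2 + d2 g p.1.2 p.2 p.2 = 0 ->
  (forall i, dot (theta p.1.2 i) (theta y2 i) =
    - dot (theta p.2 i) (theta p.2 i)) ->
  tangent (Mset g) p (k *: ((1, p.2, y2) : jet R nb)).
Proof.
case: p => [[t y] y1] /= Mp rk gy2 sy2.
have [k0|k0] := eqVneq k 0.
  exists 1, (fun=> (t, y, y1)); split=> //.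
  - by move=> j; exact: Ck_cst.
  - by rewrite derive1_cst k0 scale0r.
have /Mset_all_constraints[/= hy jhy1] := Mp.
have /all_constraints_eq0[ys gy] := hy.
have [P jP] := all_constraints_right_inverse ys rk.
have ha : jac all_constraints y *m (k *: y1) = 0 by rewrite -scalemxAr jhy1
  scaler0.
have jhy2 : jac all_constraints y *m y2 + d2 all_constraints y y1 y1 = 0.
  rewrite jacE // derive_all_constraints d2_all_constraints add_col_mx gy2.
  rewrite -[RHS]col_mx0; congr col_mx; apply/colP => i; rewrite !mxE sy2.
  by rewrite mulrN addNr.
have hb : jac all_constraints y *m ((k * k) *: y2)
    + d2 all_constraints y (k *: y1) (k *: y1) = 0.
  rewrite (d2_scale _ _ _ (all_constraints_smooth 2)).
  by rewrite -scalemxAr -scalerDr jhy2 scaler0.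
have [e [c [e0 c_smooth hc c0 [dc0 ddc0]]]] :=
  curve_through_jet all_constraints_smooth hy jP ha hb.
have oB : open (ball (0 : R^o) e) by exact: ball_open.
have B0 : ball (0 : R^o) e 0 by exact: ballxx.
have dc : differentiable c 0 by have [+ _] := c_smooth 1; exact.
have ddc : differentiable ('D_1 c) 0 by have [_ /(_ 1)[+ _]] := c_smooth 2;
  exact.
have dt : is_derive (0 : R^o) (1 : R^o) (fun s : R^o => t + s * k : R^o) k.
  have := is_deriveD (is_derive_cst t (0 : R^o) (1 : R^o))
    (is_derive_scale (k : R^o) (0 : R^o)).
  by rewrite add0r.
have ddt : differentiable (fun s : R^o => t + s * k : R^o) (0 : R^o).
  by apply/derivable1_diffP; case: dt.
(* The curve [c] has velocity [k y1] and acceleration [k^2 y2] at [0]. *)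
exists e, (fun s : R^o => (t + s * k, c s, k^-1 *: 'D_1 c s)); split=> //.
- move=> j; apply: (Ck_pair oB); first apply: (Ck_pair oB).
  + apply: (CkD oB (f := fun=> t) (g := fun s : R^o => s * k));
    first exact: Ck_cst.
    by apply: (CkM oB); [exact: Ck_id|exact: Ck_cst].
  + exact: c_smooth.
  + apply: (Ck_scalemx oB); first exact: Ck_cst.
    by have [_ /(_ 1)] := c_smooth j.+1.
- move=> s Bs; apply/Mset_all_constraints; split=> /=; first exact: hc.
  have [h1 _] := constraint_derivatives (all_constraints_smooth 2) oB
    (c_smooth 2) hc Bs.
  by rewrite -scalemxAr h1 scaler0.
- by rewrite c0 dc0 mul0r addr0 scalerA mulVf // scale1r.
rewrite derive1E derive_pair; last 1 first.
- exact: differentiableZ.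
- rewrite derive_pair // derive_val dc0 deriveZ; last exact: diff_derivable.
  rewrite ddc0 scalerA mulKf //.
  by congr (_, _, _); rewrite /= [RHS]mulr1.
- exact: differentiable_pair.
Qed.

End StateManifold.

(** * Motions *)

(** The equation of motion is paired with [H *m y1]. The constraint force does no work because
    [A *m y1 = 0], and symmetry of [E] merges the two halves of the kinetic term. *)
Lemma power_balance (R : realType) n p l (H : 'M[R]_(p, n)) (E : 'M[R]_p)
    (A : 'M[R]_(l, n)) (y1 gU : 'cV[R]_n) (w K f : 'cV[R]_p) (lam :
      'cV[R]_l) dU :
  E^T = E -> H^T *m (H *m y1) = y1 -> dot (H *m y1) K = 0 -> dot gU y1 = dU ->
  A *m y1 = 0 -> E *m w + H *m A^T *m lam = f - 8 *: K - H *m gU ->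
  2^-1 * (dot w (E *m (H *m y1)) + dot (H *m y1) (E *m w)) + dU =
  dot (H *m y1) f.
Proof.
move=> Es vE KE <- Ay1 /(congr1 (dot (H *m y1))).
have dotH (x : 'cV[R]_n) : dot (H *m y1) (H *m x) = dot y1 x.
  by rewrite -{2}(trmxK H) -dot_mulmx vE.
rewrite -mulmxA !dotDr !dotNr dotZr KE !dotH -dot_mulmx Ay1 dot0l.
have -> : dot w (E *m (H *m y1)) = dot (H *m y1) (E *m w).
  by rewrite dotC dot_mulmx Es.
by rewrite (dotC gU); lra.
Qed.

Section Motions.
Context {R : realType} {nb l : nat} (m : 'I_nb -> R) (J : 'I_nb -> 'M[R]_3)
  (F tau : 'I_nb -> jet R nb -> 'cV[R]_3) (U : 'cV[R]_(ydim nb) -> R)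
  (g : 'cV[R]_(ydim nb) -> 'cV[R]_l).
Context (m_gt0 : forall i, 0 < m i) (J_sym : forall i, (J i)^T = J i)
  (J_posdef : forall i (w : 'cV[R]_3), w != 0 -> 0 < dot w (J i *m w))
  (U_smooth : smooth_on setT (U : 'cV[R]_(ydim nb) -> R^o))
  (g_smooth : smooth_on setT g)
  (g_indep : forall p : jet R nb, Mset g p ->
     \rank (jac g p.1.2 *m (Hbig p.1.2)^T) = l).

Let U_diff y : differentiable (U : _ -> R^o) y.
Proof. by have [+ _] := U_smooth 1; exact. Qed.

Let g_diff y : differentiable g y.
Proof. by have [+ _] := g_smooth 1; exact. Qed.

Lemma dynsys_unique_solution p : Mset g p ->
  exists! dl : 'cV[R]_(qdim nb) * 'cV[R]_l, dynsys m J F tau U g p dl.1 dl.2.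
Proof.
move=> Mp; have := saddle_point_system
  (Fext F tau p - 8 *: Ktilde J p.1.2 p.2 - Hbig p.1.2 *m grad U p.1.2)
  (jac g p.1.2 *m Ibig p.2 *m p.1.2 - d2 g p.1.2 p.2 p.2)
  (fun d => @Ebig_posdef R nb m J d m_gt0 J_posdef) (g_indep Mp).
by rewrite trmx_mul trmxK.
Qed.

Lemma dynsys_inj p d d' lam lam' : Mset g p ->
  dynsys m J F tau U g p d lam -> dynsys m J F tau U g p d' lam' -> d = d'.
Proof.
move=> Mp h h'; have [u [_ uniq]] := dynsys_unique_solution Mp.
have [<- _] : (d, lam) = (d', lam') by rewrite -(uniq (d, lam)) // -(uniq (d',
  lam')).
by [].
Qed.

Context (I : set R) (y : R -> 'cV[R]_(ydim nb)) (oI : open I)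
  (y_smooth : @smooth_on R R^o _ I y).

Let oI' : open (I : set R^o). Proof. exact: oI. Qed.
Let yC2 : @Ck R R^o _ 2 I y. Proof. exact: y_smooth. Qed.

Lemma is_interval_ball (t e : R) : is_interval (ball (t : R^o) e).
Proof.
move=> a b; rewrite -ball_normE /= !ltr_distlC => /andP[a1 _] /andP[_ b2] c.
move=> /andP[ac cb]; rewrite ltr_distlC; apply/andP; split; lra.
Qed.

Lemma derive_prolong t : I t -> differentiable (prolong y) (t : R^o) /\
  derive1 (prolong y) t =
    (1, 'D_1 (y : R^o -> _) t, 'D_1 ('D_1 (y : R^o -> _)) t) :> jet R nb.
Proof.
move=> It; have [dy ddy] := yC2.
have dyt := dy t It; have ddyt : differentiable ('D_1 (y : R^o -> _)) (t : R^o).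
  by have [+ _] := ddy 1; exact.
have -> : prolong y = fun s => (s, y s, 'D_1 (y : R^o -> _) s).
  by apply/funext => s; rewrite /prolong derive1E.
have d1 : differentiable (fun s : R^o => (s, y s)) (t : R^o).
  by apply: differentiable_pair => //; exact: differentiable_id.
split; first exact: differentiable_pair.
rewrite derive1E (derive_pair _ d1 ddyt) (derive_pair _ (differentiable_id _)
  dyt).
by rewrite derive_id.
Qed.

(** The sphere of each body gets the stereographic chart centred at its own position at time [t]. By
    continuity, and since there are finitely many bodies, all these charts are valid on one common
    interval around [t]. *)
Lemma motion_equation : motion m J F tau U g I y -> forall t, I t ->
  exists lam, dynsys m J F tau U g (prolong y t)
    (Hbig (y t) *m 'D_1 ('D_1 (y : R^o -> _)) t) lam.
Proof.
move=> [ys gy EL] t It.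
pose th0 i := theta (y t) i.
have near_t : \forall s \near (t : R^o),
    I s /\ forall i, stereo_codomain (th0 i) (theta (y s) i).
  apply: filterI; first exact: open_nbhs_nbhs.
  apply: (@filter_forall _ 'I_nb
    (fun i (s : R^o) => stereo_codomain (th0 i) (theta (y s) i)) (nbhs (t :
      R^o)) _).
  move=> i; have Ct : @Ck R R^o _ 0 I (fun s => theta (y s) i).
    by apply: (Ck_linear_cV (theta_linear i) oI'); exact: y_smooth.
  have c : {for (t : R^o), continuous (fun s : R^o =>
    theta (y s) i)} by exact: Ct.
  apply: (c (stereo_codomain (th0 i))); apply: open_nbhs_nbhs; split.
    exact: open_stereo_codomain.
  by apply: stereo_codomain_center; exact: ys.
have /nbhs_ballP[e /= e0 he] := near_t.
pose I' : set R := ball (t : R^o) e.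
have oI1 : open (I' : set R^o) by exact: ball_open.
have I'I : I' `<=` I by move=> s /he[].
pose alpha i s := stereo_inv (th0 i) (theta (y s) i).
have chart s i : I' s -> (setT : set 'cV[R]_3) (alpha i s) /\
    theta (y s) i = stereo (th0 i) (alpha i s).
  move=> I's; split=> //; rewrite /alpha stereoK //.
  - exact: ys.
  - by apply: ys; exact: I'I.
  - by case: (he s I's).
have sp i : local_param setT (stereo (th0 i)) by apply: stereo_param; exact: ys.
have [lam hlam] := EL (fun=> setT) (fun i => stereo (th0 i)) I' alpha sp oI1
  (is_interval_ball (t := t) (e := e)) I'I chart.
have I't : I' t by exact: ballxx.
exists (lam t); have [_ _ E2] := constrained_curve (g_smooth 2) oI' yC2
  (fun s Is i => ys s i Is) gy It.
split; last by rewrite /= derive1E.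
rewrite /= derive1E.
have red := lagrange_equation_reduction m F tau J_sym U_diff g_diff (lam t) sp
  oI1
  (Ck_sub I'I yC2) chart I't.
apply/red; exact: hlam.
Qed.

Lemma motion_integral_curve (d : jet R nb -> 'cV[R]_(qdim nb))
    (lam : jet R nb -> 'cV[R]_l) :
  (forall p, Mset g p -> dynsys m J F tau U g p (d p) (lam p)) ->
  motion m J F tau U g I y <->
  integral_curve (Mset g) (fun p : jet R nb =>
    <[ ((1, p.2, accel p (d p)) : jet R nb) ]>%VS) I (prolong y).
Proof.
move=> hd; split=> [mot t It|ic].
  have [ys gy _] := mot.
  have [Mp acc _] := constrained_curve (g_smooth 2) oI' yC2
    (fun s Is i => ys s i Is) gy It.
  have [lt hl] := motion_equation mot It.
  have [dp pE] := derive_prolong It.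
  split=> //; first exact: diff_derivable.
  (* The multiplier [lt] comes from a chart and [lam] is given; uniqueness still identifies the two
     values of [d]. *)
  have dE := dynsys_inj Mp (hd _ Mp) hl.
  rewrite pE dE acc /= derive1E; exact: memv_line.
have st t : I t -> Mset g (prolong y t) by move=> /ic[].
have ys t i : I t -> sphere3 (theta (y t) i).
  by move=> /st[/(_ i)[+ _] _].
have gy t : I t -> g (y t) = 0 by move=> /st[_ []].
have acc t : I t -> 'D_1 ('D_1 (y : R^o -> _)) t =
    accel (prolong y t) (d (prolong y t)).
  move=> It; have [_ _] := ic t It; have [_ ->] := derive_prolong It.
  (* The time component of the prolonged curve has speed 1, which forces the coefficient [k] to be
     1. *)
  move=> /vlineP[k] [k1 _ ->].
  by move: k1; rewrite /= [_ *: _]mulr1 => <-; rewrite scale1r.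
split=> // O phi I' alpha lp oI1 _ I'I chart q.
(* The multiplier of the linear system serves in every chart at once. *)
exists (fun t => lam (prolong y t)) => t I't.
have It := I'I t I't; have Mp := st t It.
have [E1 _] := hd _ Mp.
have red := lagrange_equation_reduction m F tau J_sym U_diff g_diff
  (lam (prolong y t)) lp oI1 (Ck_sub I'I yC2) chart I't.
apply/red.
have yst : on_spheres (y t) by move=> i; exact: ys.
(* [H] recovers [d] from the acceleration: it kills the correction [I y] and is a left inverse of
   [H^T] on the spheres. *)
have -> : Hbig (y t) *m 'D_1 ('D_1 (y : R^o -> _)) t = d (prolong y t).
  rewrite (acc t It) /accel.
  move: (d _) => dp.
  by rewrite mulmxBr Hbig_Ibig subr0 mulmxA (Hbig_mul_tr yst) mul1mx.
by move: E1; rewrite /= derive1E.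
Qed.

Lemma energy_balance t : motion m J F tau U g I y -> I t ->
  is_derive (t : R^o) (1 : R^o)
    (fun s : R^o => energy m J U (y s) (derive1 y s) : R^o)
    (dot (Hbig (y t) *m derive1 y t) (Fext F tau (prolong y t))).
Proof.
move=> mot It; have [ys gy _] := mot.
have [lam [E1 _]] := motion_equation mot It.
have [g1 _] := constraint_derivatives (g_smooth 2) oI' yC2 gy It.
have s1 i := (sphere_derivatives oI' yC2 (fun s Is i => ys s i Is) i It).1.
have yst : on_spheres (y t) by move=> i; exact: ys.
move: E1; rewrite /= derive1E.
set y1 := 'D_1 _ t in g1 s1 *; set y2 := 'D_1 _ t => E1.
have [dy ddy] := yC2.
have dyt : differentiable (y : R^o -> _) (t : R^o) by exact: dy.
have ddyt : differentiable ('D_1 (y : R^o -> _)) (t : R^o).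
  by have [+ _] := ddy 1; exact.
have dHy1 := is_derive_mulmx (is_derive_Hbig (1 : R^o) dyt)
  (is_derive_diff (1 : R^o) ddyt).
rewrite Hrot_self add0r -/y2 in dHy1.
have dEHy1 := is_derive_mulmxl (Ebig m J) dHy1.
have dU : is_derive (t : R^o) (1 : R^o) ((U : _ -> R^o) \o y)
    ('D_y1 (U : _ -> R^o) (y t)).
  rewrite /y1 -(derive_comp (1 : R^o) dyt (U_diff (y t))).
  by apply: is_derive_diff; exact: differentiable_comp dyt (U_diff (y t)).
have dW := is_deriveD (is_deriveZ (2^-1 : R) (is_derive_dot dHy1 dEHy1)) dU.
have EW : (fun s : R^o => energy m J U (y s) (derive1 y s) : R^o) =
    fun s : R^o => 2^-1 * dot (Hbig (y s) *m 'D_1 (y : R^o -> _) s)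
      (Ebig m J *m (Hbig (y s) *m 'D_1 (y : R^o -> _) s)) + U (y s) : R^o.
  by apply/funext => s; rewrite /energy kineticE derive1E.
rewrite EW; apply: (is_derive_eq dW).
have vE : (Hbig (y t))^T *m (Hbig (y t) *m y1) = y1.
  exact: trHbig_mul_tangent.
(* [Ktilde] does no work: moving [H] across the pairing leaves [H^T H y_1 = y_1], and then
   [Hrot y1 *m y1 = 0]. *)
have KE : dot (Hbig (y t) *m y1) (Ktilde J (y t) y1) = 0.
  have : dot (Hbig (y t) *m y1) (4 *: Ktilde J (y t) y1) = 0.
    rewrite -(Hbig_Hrot_Ktilde m) -{2}(trmxK (Hbig (y t))) -dot_mulmx vE.
    by rewrite -dot_mulmx Hrot_self dot0l.
  by rewrite dotZr => /eqP; rewrite mulf_eq0 pnatr_eq0 => /eqP.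
have UE : dot (grad U (y t)) y1 = 'D_y1 (U : _ ->
  R^o) (y t) by exact: dot_gradl.
exact: (power_balance (Ebig_sym m J_sym) vE KE UE g1 E1).
Qed.

End Motions.

(** The sphere part holds for every [d], since [H^T d] has no component along [theta] and the
    correction [I y] supplies the centripetal one. The [g] part is the second line of the linear
    system. *)
Lemma accel_constraints (R : realType) nb l (g : 'cV[R]_(ydim nb) -> 'cV[R]_l)
    (p : jet R nb) d : Mset g p ->
  jac g p.1.2 *m (Hbig p.1.2)^T *m d =
    jac g p.1.2 *m Ibig p.2 *m p.1.2 - d2 g p.1.2 p.2 p.2 ->
  jac g p.1.2 *m accel p d + d2 g p.1.2 p.2 p.2 = 0 /\
  forall i, dot (theta p.1.2 i) (theta (accel p d) i) =
    - dot (theta p.2 i) (theta p.2 i).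
Proof.
move=> [ps _] E; split.
  by rewrite /accel mulmxBr !mulmxA E addrAC subrK subrr.
move=> i; rewrite /accel thetaD thetaN theta_trHbig Ibig_mulE theta_mxcol.
rewrite dotDr dotNr -dot_mulmx Hmat_self dot0l add0r dotZr.
by have [-> _] := ps i; rewrite mulr1.
Qed.

Theorem theorem4p1 (R : realType) (nb l : nat)
    (m : 'I_nb -> R) (J : 'I_nb -> 'M[R]_3)
    (F tau : 'I_nb -> jet R nb -> 'cV[R]_3)
    (U : 'cV[R]_(ydim nb) -> R) (g : 'cV[R]_(ydim nb) -> 'cV[R]_l)
    (m_gt0 : forall i, 0 < m i)
    (J_sym : forall i, (J i)^T = J i)
    (J_posdef : forall i (w : 'cV[R]_3), w != 0 -> 0 < dot w (J i *m w))
    (F_smooth : forall i, smooth_on setT (F i))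
    (tau_smooth : forall i, smooth_on setT (tau i))
    (U_smooth : smooth_on setT (U : 'cV[R]_(ydim nb) -> R^o))
    (g_smooth : smooth_on setT g)
    (g_indep : forall p : jet R nb, Mset g p ->
       \rank (jac g p.1.2 *m (Hbig p.1.2)^T) = l) :
  (forall p : jet R nb, Mset g p ->
     exists! dl : 'cV[R]_(qdim nb) * 'cV[R]_l,
       dynsys m J F tau U g p dl.1 dl.2)
  /\
  (forall (d : jet R nb -> 'cV[R]_(qdim nb)) (lam : jet R nb -> 'cV[R]_l),
     (forall p, Mset g p -> dynsys m J F tau U g p (d p) (lam p)) ->
     let D (p : jet R nb) : {vspace jet R nb} :=
       <[ ((1, p.2, accel p (d p)) : jet R nb) ]>%VS in
     (forall p, Mset g p ->
        \dim (D p) = 1%N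
        /\ (forall v, v \in D p -> tangent (Mset g) p v /\ cartan p v))
     /\
     (forall (I : set R) (y : R -> 'cV[R]_(ydim nb)),
        open I -> is_interval I -> @smooth_on R R^o _ I y ->
        (motion m J F tau U g I y
           <-> integral_curve (Mset g) D I (prolong y))))
  /\
  (forall (I : set R) (y : R -> 'cV[R]_(ydim nb)),
     open I -> is_interval I -> @smooth_on R R^o _ I y ->
     motion m J F tau U g I y ->
     forall t, I t ->
       is_derive (t : R^o) 1
         (fun s : R^o => energy m J U (y s) (derive1 y s) : R^o)
         (dot (Hbig (y t) *m derive1 y t) (Fext F tau (prolong y t)))).
Proof.
split; [|split].
- by move=> p Mp; exact: dynsys_unique_solution.
- move=> d lam hd D; split=> [p Mp|I y oI _ ysm]; last first.
    exact: (motion_integral_curve m_gt0 J_sym J_posdef U_smooth g_smooth g_indep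
      oI ysm hd).
  split.
    (* The spanning vector is nonzero because its time component is 1. *)
    by rewrite /D dim_vline -pair_eqE /= -pair_eqE /= oner_eq0.
  move=> v /vlineP[k ->]; have [_ E2] := hd p Mp.
  have [gacc sacc] := accel_constraints Mp E2.
  split; first by apply: tangent_Mset => //; exact: g_indep.
  by move=> j; rewrite /= !mxE [_ *: _]mulr1 mulrC subrr.
- move=> I y oI _ ysm mot t It.
  exact: (energy_balance J_sym U_smooth g_smooth oI ysm mot It).
Qed.
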